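(* Let $\{\mathbf{w}^k\}$ and $\{\widetilde{\mathbf{w}}^k\}$ be the sequences generated by GS-ADMM. Then, for any $\sigma_1\in(p-1,+\infty)$, $\sigma_2\in(q-1,+\infty)$ and $(\tau,s)\in\mathcal{K}$, where $$\mathcal{K}=\{(\tau,s)\in\mathbb{R}^2 : \tau+s>0,\ \tau\le 1,\ -\tau^2-s^2-\tau s+\tau+s+1>0\},$$ we have $$\lim_{k\to\infty}\Big(\sum_{i=1}^p\|A_i(x_i^k-x_i^{k+1})\|^2+\sum_{j=1}^q\|B_j(y_j^k-y_j^{k+1})\|^2\Big)=0,\qquad \lim_{k\to\infty}\|\mathcal{A}\mathbf{x}^k+\mathcal{B}\mathbf{y}^k-c\|=0,$$ and there exists $\mathbf{w}^\infty\in\mathcal{M}^*$ such that $\lim_{k\to\infty}\widetilde{\mathbf{w}}^k=\mathbf{w}^\infty$.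
   Context: Setting. $p,q\ge1$ are integers; $f_i:\mathbb{R}^{m_i}\to\mathbb{R}$ ($1\le i\le p$) and $g_j:\mathbb{R}^{d_j}\to\mathbb{R}$ ($1\le j\le q$) are closed proper convex functions; $A_i\in\mathbb{R}^{n\times m_i}$, $B_j\in\mathbb{R}^{n\times d_j}$ all have full column rank; $c\in\mathbb{R}^n$; $\mathcal{X}_i\subset\mathbb{R}^{m_i}$, $\mathcal{Y}_j\subset\mathbb{R}^{d_j}$ are closed convex sets. The problem is: minimize $\sum_i f_i(x_i)+\sum_j g_j(y_j)$ subject to $\sum_i A_ix_i+\sum_j B_jy_j=c$, $x_i\in\mathcal{X}_i$, $y_j\in\mathcal{Y}_j$; its solution set is assumed nonempty. Notation. $\mathcal{A}=(A_1,\dots,A_p)$, $\mathcal{B}=(B_1,\dots,B_q)$, $\mathbf{x}=(x_1;\dots;x_p)$, $\mathbf{y}=(y_1;\dots;y_q)$, $\mathcal{X}=\prod_i\mathcal{X}_i$, $\mathcal{Y}=\prod_j\mathcal{Y}_j$, $\mathcal{M}=\mathcal{X}\times\mathcal{Y}\times\mathbb{R}^n$, $\mathbf{u}=(\mathbf{x};\mathbf{y})$, $\mathbf{w}=(\mathbf{x};\mathbf{y};\lambda)$, $h(\mathbf{u})=\sum_{i=1}^pf_i(x_i)+\sum_{j=1}^qg_j(y_j)$, $\mathcal{J}(\mathbf{w})=(-\mathcal{A}^{\sf T}\lambda;\,-\mathcal{B}^{\sf T}\lambda;\,\mathcal{A}\mathbf{x}+\mathcal{B}\mathbf{y}-c)$.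 For $\beta>0$, $\mathcal{L}_\beta(\mathbf{x},\mathbf{y},\lambda)=h(\mathbf{u})-\langle\lambda,\mathcal{A}\mathbf{x}+\mathcal{B}\mathbf{y}-c\rangle+\frac{\beta}{2}\|\mathcal{A}\mathbf{x}+\mathcal{B}\mathbf{y}-c\|^2$. $\mathcal{M}^*$ is the set of $\mathbf{w}^*\in\mathcal{M}$ with $h(\mathbf{u})-h(\mathbf{u}^* )+\langle\mathbf{w}-\mathbf{w}^*,\mathcal{J}(\mathbf{w}^* )\rangle\ge0$ for all $\mathbf{w}\in\mathcal{M}$. GS-ADMM (parameters $\beta>0,\sigma_1,\sigma_2,\tau,s$). From an initial $\mathbf{w}^0=(\mathbf{x}^0;\mathbf{y}^0;\lambda^0)\in\mathcal{M}$, for $k=0,1,2,\dots$: (1) for each $i$, $x_i^{k+1}=\arg\min_{x_i\in\mathcal{X}_i}\mathcal{L}_\beta(x_1^k,\dots,x_i,\dots,x_p^k,\mathbf{y}^k,\lambda^k)+\frac{\sigma_1\beta}{2}\|A_i(x_i-x_i^k)\|^2$; (2) $\lambda^{k+\frac12}=\lambda^k-\tau\beta(\mathcal{A}\mathbf{x}^{k+1}+\mathcal{B}\mathbf{y}^k-c)$; (3) for each $j$, $y_j^{k+1}=\arg\min_{y_j\in\mathcal{Y}_j}\mathcal{L}_\beta(\mathbf{x}^{k+1},y_1^k,\dots,y_j,\dots,y_q^k,\lambda^{k+\frac12})+\frac{\sigma_2\beta}{2}\|B_j(y_j-y_j^k)\|^2$; (4) $\lambda^{k+1}=\lambda^{k+\frac12}-s\beta(\mathcal{A}\mathbf{x}^{k+1}+\mathcal{B}\mathbf{y}^{k+1}-c)$.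 Here $\mathbf{w}^k=(\mathbf{x}^k;\mathbf{y}^k;\lambda^k)$, and $\widetilde{\mathbf{w}}^k=(\mathbf{x}^{k+1};\mathbf{y}^{k+1};\widetilde\lambda^k)$ with $\widetilde\lambda^k=\lambda^k-\beta(\mathcal{A}\mathbf{x}^{k+1}+\mathcal{B}\mathbf{y}^k-c)$.
   Formalization: The set M* is additionally assumed nonempty: a nonempty solution set of the problem alone does not guarantee a multiplier, and without one the claimed limit in M* cannot exist. *)

(* Defs.v *)
From HB Require Import structures.
From mathcomp Require Export all_boot all_order all_algebra.
From mathcomp Require Export all_classical all_reals all_analysis.
Export Order.TTheory GRing.Theory Num.Theory.
Export numFieldNormedType.Exports.

Set Implicit Arguments.
Unset Strict Implicit.
Unset Printing Implicit Defensive.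

Local Open Scope classical_set_scope.
Local Open Scope ring_scope.

(* The norm `|v| that the library puts on matrices is the sup norm, hence the
   Euclidean structure below.  On 'cV[R]_N both induce the same topology. *)
Definition inner (R : realType) (N : nat) (u v : 'cV[R]_N) : R :=
  \sum_(i < N) u i 0 * v i 0.

Definition enorm (R : realType) (N : nat) (u : 'cV[R]_N) : R :=
  Num.sqrt (inner u u).

Definition argmin (R : realType) (T : Type) (D : set T) (F : T -> R) : set T :=
  [set z | D z /\ forall z', D z' -> F z <= F z'].

(* Closedness is closedness of the epigraph; properness is automatic for a
   function with values in R. *)
Definition closed_proper_convex (R : realType) (N : nat)
    (F : 'cV[R]_N -> R) : Prop :=
  closed [set z : 'cV[R]_N * R | F z.1 <= z.2] /\ convex_function setT F.

Record problem (R : realType) (n p q : nat)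
    (m : 'I_p -> nat) (d : 'I_q -> nat) := Problem {
  obj_f : forall i, 'cV[R]_(m i) -> R;
  obj_g : forall j, 'cV[R]_(d j) -> R;
  mat_A : forall i, 'M[R]_(n, m i);
  mat_B : forall j, 'M[R]_(n, d j);
  rhs_c : 'cV[R]_n;
  set_X : forall i, set 'cV[R]_(m i);
  set_Y : forall j, set 'cV[R]_(d j)
}.
Arguments obj_f {R n p q m d} P i : rename.
Arguments obj_g {R n p q m d} P j : rename.
Arguments set_X {R n p q m d} P i : rename.
Arguments set_Y {R n p q m d} P j : rename.

(* x = (x_1; ...; x_p) is a single column of height \sum_i m i whose i-th block
   is submxcol x i. *)
Notation bvec R m := 'cV[R]_(\sum_i m i).
Notation wvec R n m d := 'cV[R]_((\sum_i m i) + ((\sum_j d j) + n)).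

Section Defs.
Context (R : realType) (n p q : nat) (m : 'I_p -> nat) (d : 'I_q -> nat).
Implicit Types (P : problem R n m d) (x : bvec R m) (y : bvec R d)
  (lam : 'cV[R]_n) (w : wvec R n m d).

Definition wtriple x y lam : wvec R n m d := col_mx x (col_mx y lam).
Definition wx w : bvec R m := usubmx w.
Definition wy w : bvec R d := usubmx (dsubmx w).
Definition wl w : 'cV[R]_n := dsubmx (dsubmx w).

Definition Aall P : 'M[R]_(n, \sum_i m i) := \mxrow_i mat_A P i.
Definition Ball P : 'M[R]_(n, \sum_j d j) := \mxrow_j mat_B P j.
Definition Xall P : set (bvec R m) := [set x | forall i, set_X P i (submxcol x i)].
Definition Yall P : set (bvec R d) := [set y | forall j, set_Y P j (submxcol y j)].
Definition Mall P : set (wvec R n m d) :=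
  [set w | Xall P (wx w) /\ Yall P (wy w)].

Definition h P x y : R :=
  \sum_i obj_f P i (submxcol x i) + \sum_j obj_g P j (submxcol y j).

Definition residual P x y : 'cV[R]_n := Aall P *m x + Ball P *m y - rhs_c P.

Definition solutions P : set (bvec R m * bvec R d) :=
  argmin [set u | [/\ Xall P u.1, Yall P u.2 &
                     Aall P *m u.1 + Ball P *m u.2 = rhs_c P]]
         (fun u => h P u.1 u.2).

Definition J P w : wvec R n m d :=
  wtriple (- ((Aall P)^T *m wl w)) (- ((Ball P)^T *m wl w))
          (residual P (wx w) (wy w)).

Definition Mstar P : set (wvec R n m d) :=
  [set ws | Mall P ws /\ forall w, Mall P w ->
     0 <= h P (wx w) (wy w) - h P (wx ws) (wy ws) + inner (w - ws) (J P ws)].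

Definition auglag P (beta : R) x y lam : R :=
  h P x y - inner lam (residual P x y)
  + beta / 2 * enorm (residual P x y) ^+ 2.

Definition replace_block (l : nat) (e : 'I_l -> nat)
    (x : bvec R e) (i : 'I_l) (z : 'cV[R]_(e i)) : bvec R e :=
  \mxcol_k dfwith (submxcol x) i z k.

(* lambda^{k+1/2} *)
Definition lam_half P (beta tau : R) (w : nat -> wvec R n m d) (k : nat) :
    'cV[R]_n :=
  wl (w k) - (tau * beta) *: residual P (wx (w k.+1)) (wy (w k)).

(* As the A_i and B_j have full column rank, each subproblem has at most one
   minimizer, so membership in argmin is the equation x_i^{k+1} = argmin. *)
Definition GS_ADMM P (beta sigma1 sigma2 tau s : R)
    (w : nat -> wvec R n m d) : Prop :=
  Mall P (w 0%N) /\
  forall k : nat,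
  [/\ forall i : 'I_p,
        argmin (set_X P i)
          (fun z => auglag P beta (replace_block (wx (w k)) z) (wy (w k))
                      (wl (w k))
             + sigma1 * beta / 2
               * enorm (mat_A P i *m (z - submxcol (wx (w k)) i)) ^+ 2)
          (submxcol (wx (w k.+1)) i),
      forall j : 'I_q,
        argmin (set_Y P j)
          (fun z => auglag P beta (wx (w k.+1)) (replace_block (wy (w k)) z)
                      (lam_half P beta tau w k)
             + sigma2 * beta / 2
               * enorm (mat_B P j *m (z - submxcol (wy (w k)) j)) ^+ 2)
          (submxcol (wy (w k.+1)) j)
    & wl (w k.+1) = lam_half P beta tau w k
        - (s * beta) *: residual P (wx (w k.+1)) (wy (w k.+1))].

Definition wtilde P (beta : R) (w : nat -> wvec R n m d) (k : nat) :
    wvec R n m d :=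
  wtriple (wx (w k.+1)) (wy (w k.+1))
    (wl (w k) - beta *: residual P (wx (w k.+1)) (wy (w k))).

End Defs.

Definition Kset (R : realType) : set (R * R) :=
  [set ts | let: (tau, s) := ts in
     [/\ 0 < tau + s, tau <= 1 &
         0 < - tau ^+ 2 - s ^+ 2 - tau * s + tau + s + 1]].

(* Main.v *)
(** Convergence by a Lyapunov function.  Fix w* in M^*, put u_i = A_i (x_i - x_i^* ),
    v_j = B_j (y_j - y_j^* ), nu = (lambda - lambda^* ) / beta, V = \sum_j v_j, and let
    r' be the residual and e'_j the increment of v_j at the new iterate.  Adding the
    optimality conditions of all the subproblems to the variational inequality of w*
    shows that
      Phi = (1 + sigma1) \sum |u_i|^2 - |\sum u_i|^2
            + (1 + sigma2) \sum |v_j|^2 - tau |V|^2 + |nu - tau V|^2 / (tau + s)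
    decreases at each step, up to a term 2 (1 - tau) <r', \sum e'_j>.  Comparing
    the y-subproblems of two consecutive steps bounds this term by quantities
    that telescope once Phi is augmented with
      (1 - s)^2 / (1 + tau) |r|^2
      + (1 - tau) / (1 + tau) ((1 + sigma2) \sum |e_j|^2 - |\sum e_j|^2),
    and the definition of the set K says exactly that the remaining coefficient
    2 - tau - s - (1 - s)^2 / (1 + tau) of -|r'|^2 is positive.  So increments and
    residuals tend to 0 and the iterates are bounded (full column rank); a limit
    of a subsequence is in M^* (closed epigraphs), and the Lyapunov function
    centered at that limit is nonincreasing and tends to 0 along the subsequence,
    hence tends to 0. *)

Require Import Defs.
From mathcomp Require Import ring lra.

Set Implicit Arguments.
Unset Strict Implicit.
Unset Printing Implicit Defensive.

Local Open Scope classical_set_scope.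
Local Open Scope ring_scope.

(** * Bilinearity of the Euclidean inner product and a sum inequality *)

Section InnerProduct.
Context (R : realType).

Lemma innerC N (u v : 'cV[R]_N) : inner u v = inner v u.
Proof. by apply: eq_bigr => i _; rewrite mulrC. Qed.

Lemma innerDl N (u v t : 'cV[R]_N) : inner (u + v) t = inner u t + inner v t.
Proof. by rewrite -big_split; apply: eq_bigr => i _; rewrite mxE mulrDl. Qed.

Lemma innerZl N a (u v : 'cV[R]_N) : inner (a *: u) v = a * inner u v.
Proof. by rewrite mulr_sumr; apply: eq_bigr => i _; rewrite mxE mulrA. Qed.

Lemma innerNl N (u v : 'cV[R]_N) : inner (- u) v = - inner u v.
Proof. by rewrite -scaleN1r innerZl mulN1r. Qed.

Lemma innerDr N (u v t : 'cV[R]_N) : inner t (u + v) = inner t u + inner t v.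
Proof. by rewrite innerC innerDl !(innerC t). Qed.

Lemma innerZr N a (u v : 'cV[R]_N) : inner u (a *: v) = a * inner u v.
Proof. by rewrite innerC innerZl (innerC u). Qed.

Lemma innerNr N (u v : 'cV[R]_N) : inner u (- v) = - inner u v.
Proof. by rewrite innerC innerNl (innerC u). Qed.

Lemma inner0l N (u : 'cV[R]_N) : inner 0 u = 0.
Proof. by rewrite -(scale0r 0) innerZl mul0r. Qed.

Definition innerE := (innerDl, innerDr, innerNl, innerNr, innerZl, innerZr).

Lemma inner_suml (I : finType) N (F : I -> 'cV[R]_N) v :
  inner (\sum_i F i) v = \sum_i inner (F i) v.
Proof.
by elim/big_rec2: _ => [|i a b _ <-]; rewrite ?inner0l ?innerDl.
Qed.

Lemma inner_sumr (I : finType) N (F : I -> 'cV[R]_N) v :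
  inner v (\sum_i F i) = \sum_i inner v (F i).
Proof. by rewrite innerC inner_suml; apply: eq_bigr => i _; rewrite innerC. Qed.

Lemma inner_ge0 N (u : 'cV[R]_N) : 0 <= inner u u.
Proof. by apply: sumr_ge0 => i _; rewrite -expr2 sqr_ge0. Qed.

Lemma sqr_coord_le N (u : 'cV[R]_N) i : u i 0 ^+ 2 <= inner u u.
Proof.
rewrite /inner (bigD1 i) //= expr2.
by rewrite lerDl sumr_ge0 // => k _; rewrite -expr2 sqr_ge0.
Qed.

Lemma inner_eq0 N (u : 'cV[R]_N) : inner u u <= 0 -> u = 0.
Proof.
move=> u0; apply/colP => i; rewrite mxE; apply/eqP; rewrite -sqrf_eq0.
by rewrite eq_le sqr_ge0 andbT (le_trans (sqr_coord_le u i)).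
Qed.

Lemma enorm_sqr N (u : 'cV[R]_N) : enorm u ^+ 2 = inner u u.
Proof. by rewrite sqr_sqrtr ?inner_ge0. Qed.

Lemma inner_trmx N (u v : 'cV[R]_N) : inner u v = (u^T *m v) 0 0.
Proof. by rewrite mxE; apply: eq_bigr => i _; rewrite mxE. Qed.

Lemma inner_mulmxl N M (A : 'M[R]_(M, N)) u v :
  inner (A *m u) v = inner u (A^T *m v).
Proof. by rewrite !inner_trmx trmx_mul mulmxA. Qed.

Lemma inner_col_mx N M (a c : 'cV[R]_N) (b e : 'cV[R]_M) :
  inner (col_mx a b) (col_mx c e) = inner a c + inner b e.
Proof. by rewrite !inner_trmx tr_col_mx mul_row_col mxE. Qed.

(** The nonnegative double sum of [|F i - F j|^2] expands to twice the difference of the two sides.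
    This is where the thresholds [p - 1] and [q - 1] for the proximal parameters come from. *)
Lemma ler_inner_sum l N (F : 'I_l -> 'cV[R]_N) :
  inner (\sum_i F i) (\sum_i F i) <= l%:R * \sum_i inner (F i) (F i).
Proof.
have : 0 <= \sum_i \sum_j inner (F i - F j) (F i - F j).
  by apply: sumr_ge0 => i _; apply: sumr_ge0 => j _; exact: inner_ge0.
have -> : \sum_i \sum_j inner (F i - F j) (F i - F j) =
    2 * (l%:R * \sum_i inner (F i) (F i))
    - 2 * inner (\sum_i F i) (\sum_i F i).
  under eq_bigr => i _.
    under eq_bigr => j _ do rewrite !innerE opprK (innerC (F j) (F i)).
    rewrite !big_split /= !sumrN sumr_const card_ord -inner_sumr.
    over.
  rewrite /= !big_split /= !sumrN -inner_suml sumr_const card_ord !sumrMnl.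
  by rewrite -(mulr_natl (\sum_i _) l); ring.
by rewrite -mulrBr pmulr_rge0 // subr_ge0.
Qed.

End InnerProduct.

(** * First-order optimality for a convex function plus a quadratic *)

Section Optimality.
Context (R : realType).

Lemma convex_function_le N (f : 'cV[R]_N -> R) (x y : 'cV[R]_N) (t : R) :
  convex_function setT f -> 0 <= t -> t <= 1 ->
  f (t *: x + (1 - t) *: y) <= t * f x + (1 - t) * f y.
Proof.
move=> cf t0 t1.
by apply: (cf (Itv01 t0 t1) x y); rewrite inE.
Qed.

Lemma convex_set_mem N (D : set 'cV[R]_N) (x y : 'cV[R]_N) (t : R) :
  convex_set D -> D x -> D y -> 0 <= t -> t <= 1 ->
  D (t *: x + (1 - t) *: y).
Proof.
move=> cD Dx Dy t0 t1; apply/set_mem.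
by apply: (cD x y (Itv01 t0 t1)); rewrite inE.
Qed.

(** Dividing by [t] and letting [t] tend to 0 gives the claim; the proof uses one explicit small [t]
    instead of a limit. *)
Lemma ge0_of_quadratic (a c : R) :
  (forall t, 0 <= t -> t <= 1 -> 0 <= t * a + t ^+ 2 * c) -> 0 <= a.
Proof.
move=> H; rewrite leNgt; apply/negP => a0.
(* For [a < 0] this [t] lies in [(0, 1]] and keeps [t * |c|] strictly below [- a], so
   [a + t * c < 0]. *)
pose t := - a / (`|c| + - a *+ 2).
have dpos : 0 < `|c| + - a *+ 2.
  by rewrite ltr_wpDl // pmulrn_lgt0 // oppr_gt0.
have t0 : 0 < t by rewrite divr_gt0 // oppr_gt0.
have t1 : t <= 1.
  by rewrite ler_pdivrMr // mul1r -mulr_natl; have := normr_ge0 c; lra.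
have tc : t * `|c| < - a.
  rewrite /t mulrAC ltr_pdivrMr // -mulr_natl.
  by have := normr_ge0 c; nra.
have := H _ (ltW t0) t1; rewrite expr2 -mulrA -mulrDr pmulr_rge0 //.
apply/negP; rewrite -ltNge; have := ler_norm c; nra.
Qed.

(** Minimality is tested on the segment from [z0] to [z]: convexity bounds [f] there, and [Q] is
    exactly quadratic with slope [g] at [z0], so no differentiability of [f] enters. *)
Lemma argmin_variational N (D : set 'cV[R]_N) (f Q : 'cV[R]_N -> R)
    (z0 z : 'cV[R]_N) (g c : R) :
  convex_set D -> convex_function setT f ->
  argmin D (fun z => f z + Q z) z0 -> D z ->
  (forall t, Q (t *: z + (1 - t) *: z0) = Q z0 + t * g + t ^+ 2 * c) ->
  0 <= f z - f z0 + g.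
Proof.
move=> cD cf [Dz0 zmin] Dz Qt; apply: (@ge0_of_quadratic _ c) => t t0 t1.
have := zmin _ (convex_set_mem cD Dz Dz0 t0 t1); rewrite Qt.
have := convex_function_le z z0 cf t0 t1; lra.
Qed.

(** Abstract form of one block subproblem: [x] is the old block, [r] the residual before the update,
    and [C] collects the objective terms of all other blocks. *)
Lemma proximal_variational n N (D : set 'cV[R]_N) (f : 'cV[R]_N -> R)
    (A : 'M[R]_(n, N)) (lam r : 'cV[R]_n) (x z0 z : 'cV[R]_N)
    (b sigma C : R) :
  convex_set D -> convex_function setT f ->
  argmin D (fun z => f z + (C - inner lam (r + A *m (z - x))
     + b / 2 * inner (r + A *m (z - x)) (r + A *m (z - x))
     + sigma * b / 2 * inner (A *m (z - x)) (A *m (z - x)))) z0 ->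
  D z ->
  0 <= f z - f z0 + inner (A *m (z - z0))
     (b *: (r + (1 + sigma) *: (A *m (z0 - x))) - lam).
Proof.
move=> cD cf zmin Dz.
apply: (argmin_variational (c := (1 + sigma) * b / 2
  * inner (A *m (z - z0)) (A *m (z - z0))) cD cf zmin Dz) => t.
have -> : t *: z + (1 - t) *: z0 - x = (z0 - x) + t *: (z - z0).
  by apply/colP => i; rewrite !mxE; ring.
rewrite mulmxDr -scalemxAr.
move: (A *m (z0 - x)) (A *m (z - z0)) => e v.
rewrite !innerE (innerC v r) (innerC v e) (innerC e r) (innerC v lam); lra.
Qed.

End Optimality.

(** * Algebra of the energy and its decrease, on abstract vectors *)

Section Energy.
Context (R : realType) (n : nat).
Implicit Types (c kappa sigma tau s : R) (nu : 'cV[R]_n).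

(** The quadratic form of [c I - kappa E], with [E] the all-ones block matrix. The part [c I] comes
    from the separate block updates, the part in [E] from the other blocks being kept at their old
    values. *)
Definition block_quad l c kappa (u : 'I_l -> 'cV[R]_n) : R :=
  c * (\sum_i inner (u i) (u i)) - kappa * inner (\sum_i u i) (\sum_i u i).

(** Replacing [kappa] by 1 only lowers the form, and [ler_inner_sum] bounds the square of the
    sum. *)
Lemma block_quad_ge l sigma kappa (u : 'I_l -> 'cV[R]_n) : kappa <= 1 ->
  (1 + sigma - l%:R) * (\sum_i inner (u i) (u i))
    <= block_quad (1 + sigma) kappa u.
Proof.
move=> k1; rewrite /block_quad mulrBl lerB //.
apply: le_trans (ler_inner_sum u).
by rewrite -subr_ge0 -{1}(mul1r (inner _ _)) -mulrBl mulr_ge0 ?inner_ge0 ?subr_ge0.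
Qed.

Lemma block_quad_ge0 l sigma kappa (u : 'I_l -> 'cV[R]_n) : kappa <= 1 ->
  l%:R - 1 < sigma -> 0 <= block_quad (1 + sigma) kappa u.
Proof.
move=> k1 ls; apply: le_trans (block_quad_ge sigma u k1).
by rewrite mulr_ge0 ?sumr_ge0 // => [|i _]; [lra|exact: inner_ge0].
Qed.

(** The identity [2 <a, a - b> = |a|^2 - |b|^2 + |a - b|^2] for the form [block_quad]; it turns
    optimality conditions into differences of energies. *)
Lemma block_quad_polar l c kappa (u u' : 'I_l -> 'cV[R]_n) :
  2 * (c * (\sum_i inner (u' i) (u' i - u i))
       - kappa * inner (\sum_i u' i) (\sum_i (u' i - u i)))
  = block_quad c kappa u' - block_quad c kappa u
    + block_quad c kappa (fun i => u' i - u i).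
Proof.
rewrite /block_quad sumrB.
have -> : \sum_i inner (u' i - u i) (u' i - u i) =
    \sum_i inner (u i) (u i) - \sum_i inner (u' i) (u' i)
    + 2 * \sum_i inner (u' i) (u' i - u i).
  rewrite mulr_sumr -sumrB -big_split; apply: eq_bigr => i _ /=.
  by rewrite !innerE (innerC (u i) (u' i)); ring.
move: (\sum_i u' i) (\sum_i u i) => U' U.
by rewrite !innerE (innerC U U'); ring.
Qed.

Definition energy p q sigma1 sigma2 tau s
    (u : 'I_p -> 'cV[R]_n) (v : 'I_q -> 'cV[R]_n) nu : R :=
  block_quad (1 + sigma1) 1 u + block_quad (1 + sigma2) tau v
  + (tau + s)^-1 * inner (nu - tau *: \sum_j v j) (nu - tau *: \sum_j v j).

(** Here [r] is the new residual and [rho] the one between the two updates. As [rho = r - (V' - V)],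
    where [V] and [V'] are the sums of [v] and [v'], the term [- tau <V', rho>] contributes
    [tau <V', V' - V>], which explains [kappa = tau] in the form for [v]. *)
Lemma energy_step p q sigma1 sigma2 tau s (u u' : 'I_p -> 'cV[R]_n)
    (v v' : 'I_q -> 'cV[R]_n) nu nu' (r rho : 'cV[R]_n) :
  0 < tau + s ->
  r = \sum_i u' i + \sum_j v' j -> rho = \sum_i u' i + \sum_j v j ->
  nu' = nu - tau *: rho - s *: r ->
  0 <= inner r (nu - rho)
       - ((1 + sigma1) * (\sum_i inner (u' i) (u' i - u i))
          - inner (\sum_i u' i) (\sum_i (u' i - u i)))
       - tau * inner (\sum_j v' j) rho
       - (1 + sigma2) * (\sum_j inner (v' j) (v' j - v j)) ->
  energy sigma1 sigma2 tau s u' v' nu' <= energy sigma1 sigma2 tau s u v nu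
    - block_quad (1 + sigma1) 1 (fun i => u' i - u i)
    - block_quad (1 + sigma2) tau (fun j => v' j - v j)
    - (2 - tau - s) * inner r r
    + 2 * (1 - tau) * inner r (\sum_j (v' j - v j)).
Proof.
move=> ts0 rE rhoE nuE H.
have := block_quad_polar (1 + sigma1) 1 u u'.
have := block_quad_polar (1 + sigma2) tau v v'.
have -> : nu' = nu + tau *: (\sum_j v' j - \sum_j v j) - (tau + s) *: r.
  by rewrite nuE rE rhoE; apply/colP => i; rewrite !mxE; ring.
rewrite /energy; move: H; rewrite !sumrB.
(* The combination [nu - tau V] moves along [r] only, by [- (tau + s) r]; the weight [(tau + s)^-1]
   in the energy then cancels one factor. *)
have -> : nu + tau *: (\sum_j v' j - \sum_j v j) - (tau + s) *: r
    - tau *: (\sum_j v' j) = (nu - tau *: \sum_j v j) - (tau + s) *: r.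
  by apply/colP => i; rewrite !mxE; ring.
have rhoE' : rho = r - \sum_j v' j + \sum_j v j.
  by rewrite rhoE rE; apply/colP => i; rewrite !mxE; ring.
have -> : \sum_i u' i = r - \sum_j v' j by rewrite rE addrK.
rewrite rhoE'.
move: (\sum_i u i) (\sum_j v' j) (\sum_j v j) => U V' V.
move: (\sum_i inner (u' i) _) (\sum_i inner (v' i) _) => x y.
move: (block_quad _ _ _) (block_quad _ _ _) (block_quad _ _ _)
 (block_quad _ _ _) (block_quad _ _ _) (block_quad _ _ _) => b1 b2 b3 b4 b5 b6.
have -> : inner (nu - tau *: V - (tau + s) *: r) (nu - tau *: V - (tau + s) *: r)
  = inner (nu - tau *: V) (nu - tau *: V) + (tau + s) *
     ((tau + s) * inner r r - 2 * inner (nu - tau *: V) r).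
  by rewrite !innerE (innerC r nu) (innerC V nu) (innerC r V); ring.
rewrite (mulrDr (tau + s)^-1) mulKf ?gt_eqF //.
move: (_^-1 * _) => e.
rewrite !innerE !(innerC _ r).
by lra.
Qed.

(* The hypothesis is obtained by testing the y-optimality conditions of two
   consecutive iterations against each other, with [e] and [e'] the old and the
   new increments. *)
Lemma cross_term_le q sigma tau s (e e' : 'I_q -> 'cV[R]_n) (r r' : 'cV[R]_n) :
  q%:R - 1 < sigma ->
  0 <= inner (\sum_j e' j) ((1 - s) *: r - (1 + tau) *: r'
           + (1 + tau) *: (\sum_j e' j) - \sum_j e j)
       - (1 + sigma) * (\sum_j inner (e' j) (e' j - e j)) ->
  2 * (1 + tau) * inner r' (\sum_j e' j) <=
    2 * (1 - s) * inner r (\sum_j e' j)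
    + 2 * tau * inner (\sum_j e' j) (\sum_j e' j)
    - block_quad (1 + sigma) 1 e' + block_quad (1 + sigma) 1 e.
Proof.
move=> hs; have := block_quad_polar (1 + sigma) 1 e e'.
have := block_quad_ge0 (fun j => e' j - e j) (lexx 1) hs.
rewrite !sumrB.
move: (\sum_j e' j) (\sum_j e j) (\sum_j inner _ _) => E' E y.
move: (block_quad _ _ _) (block_quad _ _ _) (block_quad _ _ _) => b1 b2 b3.
rewrite !innerE !(innerC E'); lra.
Qed.

(** Multiplied by [1 + tau], the last inequality is the quadratic condition defining [Kset]. *)
Lemma Kset_bounds tau s : Kset (tau, s) ->
  [/\ 0 < tau + s, tau <= 1, 0 < 1 + tau &
    0 < (2 - tau - s) - (1 - s) ^+ 2 / (1 + tau)].
Proof.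
move=> [ts t1 K].
have t0 : 0 < 1 + tau.
  rewrite ltNge; apply/negP => t0.
  (* As a quadratic in [s], the expression has discriminant
     [(5 - 3 * tau) * (1 + tau)]. *)
  have := sqr_ge0 (2 * s + tau - 1); nra.
split => //; rewrite subr_gt0 ltr_pdivrMr //; move: K; rewrite !expr2; lra.
Qed.

(** The factor [theta] scales the cross-term bound so that its left side is the bad term
    [2 (1 - tau) <r', E'>], with [E'] the sum of [e']. The terms in [|E'|^2] then add up to
    [theta (1 + tau) = 1 - tau], which changes the form with parameter [tau] into the one with
    parameter 1. *)
Lemma energy_decrease p q sigma1 sigma2 tau s (kappa theta Phi Phi' : R)
    (du : 'I_p -> 'cV[R]_n) (e e' : 'I_q -> 'cV[R]_n) (r r' : 'cV[R]_n) :
  Kset (tau, s) ->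
  kappa = (1 - s) ^+ 2 / (1 + tau) -> theta = (1 - tau) / (1 + tau) ->
  Phi' <= Phi - block_quad (1 + sigma1) 1 du - block_quad (1 + sigma2) tau e'
    - (2 - tau - s) * inner r' r' + 2 * (1 - tau) * inner r' (\sum_j e' j) ->
  2 * (1 + tau) * inner r' (\sum_j e' j) <=
    2 * (1 - s) * inner r (\sum_j e' j)
    + 2 * tau * inner (\sum_j e' j) (\sum_j e' j)
    - block_quad (1 + sigma2) 1 e' + block_quad (1 + sigma2) 1 e ->
  Phi' + kappa * inner r' r' + theta * block_quad (1 + sigma2) 1 e' <=
  Phi + kappa * inner r r + theta * block_quad (1 + sigma2) 1 e
    - block_quad (1 + sigma1) 1 du - block_quad (1 + sigma2) 1 e'
    - (2 - tau - s - kappa) * inner r' r'.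
Proof.
move=> /Kset_bounds[ts t1 t0 eta0] kappaE thetaE step cross.
have th0 : 0 <= theta by rewrite thetaE divr_ge0 ?subr_ge0 // ltW.
have kE : (1 - s) ^+ 2 = kappa * (1 + tau) by rewrite kappaE mulfVK ?gt_eqF.
have tE : 1 - tau = theta * (1 + tau) by rewrite thetaE mulfVK ?gt_eqF.
have {}cross := ler_wpM2l th0 cross.
have -> : block_quad (1 + sigma2) 1 e' = block_quad (1 + sigma2) tau e'
    - (1 - tau) * inner (\sum_j e' j) (\sum_j e' j).
  by rewrite /block_quad; ring.
move: step cross.
have -> : block_quad (1 + sigma2) 1 e' = block_quad (1 + sigma2) tau e'
    - (1 - tau) * inner (\sum_j e' j) (\sum_j e' j).
  by rewrite /block_quad; ring.
have i0 : 0 <= (1 + tau)^-1 by rewrite invr_ge0 ltW.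
(* Young's inequality for the remaining product [<r, E'>]; its share of [|r|^2] is exactly
   [kappa]. *)
have := mulr_ge0 i0
  (inner_ge0 ((1 - tau) *: (\sum_j e' j) - (1 - s) *: r)).
rewrite !innerE (innerC _ r).
move: (block_quad _ _ _) (block_quad _ _ _) (block_quad _ _ _) => b1 b2 b3.
move: (inner r' r') (inner r' (\sum_j e' j)) (inner r (\sum_j _)) (inner r r) (inner _ _)
  => rr' re' re rr ee.
have -> : (1 + tau)^-1 * ((1 - tau) * ((1 - tau) * ee)
    - (1 - tau) * ((1 - s) * re)
    + (- ((1 - s) * ((1 - tau) * re)) - - ((1 - s) * ((1 - s) * rr))))
  = theta * (1 - tau) * ee - 2 * theta * (1 - s) * re + kappa * rr.
  by rewrite thetaE kappaE; ring.
have := congr1 (fun x => x * ee) tE; have := congr1 (fun x => x * re') tE.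
lra.
Qed.

End Energy.

(** * Limits of vector sequences, subsequences and descent arguments *)

Section Limits.
Context (R : realType).

Lemma cvg_sum (V : normedModType R) (I : finType) (F : I -> nat -> V)
    (a : I -> V) :
  (forall i, F i @ \oo --> a i) ->
  (fun k => \sum_i F i k) @ \oo --> \sum_i a i.
Proof. by move=> Fa; apply: cvg_big => //; exact: add_continuous. Qed.

Lemma cvg_colP N (F : nat -> 'cV[R]_N) (a : 'cV[R]_N) :
  F @ \oo --> a <-> forall i, (fun k => F k i 0) @ \oo --> a i 0.
Proof.
split=> [Fa i|Fa].
  by apply: (cvg_comp F (fun M : 'cV[R]_N => M i 0) _ (@coord_continuous _ _ _ _ _ _)).
move=> A /nbhs_ballP[e e0 sA].
have : \forall k \near \oo, forall i, ball (a i 0) e (F k i 0).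
  by apply: filter_forall => i; apply: Fa; exact: nbhsx_ballx.
by apply: filterS => k Bk; apply: sA; split=> // i j; rewrite ord1.
Qed.

Lemma cvg_mulmx n N (A : 'M[R]_(n, N)) (F : nat -> 'cV[R]_N) a :
  F @ \oo --> a -> (fun k => A *m F k) @ \oo --> A *m a.
Proof.
move=> /cvg_colP Fa; apply/cvg_colP => i; rewrite mxE.
under eq_cvg do rewrite mxE.
by apply: cvg_sum => j; apply: cvgM => //; exact: cvg_cst.
Qed.

Lemma cvg_inner N (F G : nat -> 'cV[R]_N) a b :
  F @ \oo --> a -> G @ \oo --> b ->
  (fun k => inner (F k) (G k)) @ \oo --> inner a b.
Proof.
move=> /cvg_colP Fa /cvg_colP Gb.
by apply: cvg_sum => j; apply: cvgM.
Qed.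

Lemma cvg0_of_inner N (F : nat -> 'cV[R]_N) :
  (fun k => inner (F k) (F k)) @ \oo --> (0 : R) -> F @ \oo --> (0 : 'cV[R]_N).
Proof.
move=> F0; apply/cvg_colP => i; rewrite mxE.
apply/cvgr0Pnorm_lt => e e0.
have := F0; move/cvgr0Pnorm_lt => /(_ (e ^+ 2) (exprn_gt0 2 e0)).
apply: filterS => k; rewrite ger0_norm ?inner_ge0 // => Fk.
rewrite -ltr_sqr ?nnegrE ?normr_ge0 ?(ltW e0) // real_normK ?num_real //.
exact: le_lt_trans (sqr_coord_le _ _) Fk.
Qed.

Lemma cvg_increasing (f : nat -> nat) : increasing_seq f -> f @ \oo --> \oo.
Proof.
move=> /increasing_seqP fi; apply/cvgnyPge => A.
have fk k : (k <= f k)%N by elim: k => // k /leq_ltn_trans; apply; exact: fi.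
by exists A => // k /= /leq_trans; apply.
Qed.

Lemma cvg_subsequence (V : normedModType R) (v : nat -> V) (a : V)
    (f : nat -> nat) : increasing_seq f ->
  v @ \oo --> a -> (fun k => v (f k)) @ \oo --> a.
Proof. by move=> fi va; apply: (cvg_comp f v (cvg_increasing fi)) va. Qed.

Lemma cvg0Z (V : normedModType R) (c : R) (v : nat -> V) :
  v @ \oo --> (0 : V) -> (fun k => c *: v k) @ \oo --> (0 : V).
Proof.
by move=> v0; rewrite -(scaler0 _ c); apply: cvgZ => //; exact: cvg_cst.
Qed.

Lemma cvg0D (V : normedModType R) (v v' : nat -> V) :
  v @ \oo --> (0 : V) -> v' @ \oo --> (0 : V) ->
  (fun k => v k + v' k) @ \oo --> (0 : V).
Proof. by move=> v0 v0'; rewrite -(addr0 0); apply: cvgD. Qed.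

(** Bolzano-Weierstrass is applied to one index after another, each time along the subsequence
    already extracted; a list of indices makes this an induction. *)
Lemma common_subsequence (I : eqType) (s : seq I) (u : I -> nat -> R) :
  (forall i, exists M, forall k, `|u i k| <= M) ->
  exists2 f : nat -> nat, increasing_seq f & {in s, forall i, cvgn (u i \o f)}.
Proof.
move=> bu; elim: s => [|i s [f fi fs]]; first by exists id.
have [|g gi gs] := @bolzano_weierstrass R (u i \o f).
  have [M uM] := bu i; exists M; split; first exact: num_real.
  by move=> x Mx k _ /=; apply: le_trans (uM _) (ltW Mx).
exists (f \o g) => [a b|j]; first exact: etrans (fi _ _) (gi _ _).
rewrite inE => /orP[/eqP -> //|js].
apply/cvg_ex; have /cvg_ex[l ul] := fs _ js; exists l.
by apply: (cvg_comp g (u j \o f) (cvg_increasing gi)) ul.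
Qed.

Lemma bounded_col_subsequence N (F : nat -> 'cV[R]_N) :
  (forall i, exists M, forall k, `|F k i 0| <= M) ->
  exists2 f : nat -> nat, increasing_seq f &
    exists a : 'cV[R]_N, F \o f @ \oo --> a.
Proof.
move=> /(common_subsequence (enum 'I_N))[f fi fc]; exists f => //.
exists (\col_i lim ((fun k => F k i 0) \o f @ \oo)).
by apply/cvg_colP => i; rewrite mxE; apply: fc; rewrite mem_enum.
Qed.

Lemma bounded_mulmx n N (A : 'M[R]_(n, N)) (F : nat -> 'cV[R]_N) (M : R) :
  (forall k, inner (F k) (F k) <= M) ->
  forall i, exists C, forall k, `|(A *m F k) i 0| <= C.
Proof.
(* Each coordinate is at most [M + 1] in absolute value, since [2 |x| <= x^2 + 1] and [x^2 <= M]. *)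
move=> FM i; exists (\sum_j `|A i j| * (M + 1)) => k; rewrite mxE.
apply: le_trans (ler_norm_sum _ _ _) _; apply: ler_sum => j _; rewrite normrM.
apply: ler_wpM2l => //.
have := le_trans (sqr_coord_le (F k) j) (FM k).
have := sqr_ge0 (`|F k j 0| - 1); rewrite -(real_normK (num_real (F k j 0))).
move: (`|_|) (normr_ge0 (F k j 0)) => x; nra.
Qed.

Lemma cvg0_of_le (F t : nat -> R) (c : R) : 0 < c ->
  (forall k, 0 <= F k) -> (forall k, c * F k <= t k) ->
  t @ \oo --> (0 : R) -> F @ \oo --> (0 : R).
Proof.
move=> c0 F0 Ft t0.
apply: (@squeeze_cvgr _ _ _ _ (fun=> 0) (fun k => c^-1 * t k)).
- by near=> k; rewrite F0 /= mulrC ler_pdivlMr // mulrC.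
- exact: cvg_cst.
- rewrite -(mulr0 c^-1); apply: cvgM => //; exact: cvg_cst.
Unshelve. all: by end_near.
Qed.

Lemma nonincreasing_nonneg_cvg (Psi : nat -> R) :
  (forall k, 0 <= Psi k) -> (forall k, Psi k.+1 <= Psi k) -> cvgn Psi.
Proof.
move=> P0 Pd; apply: nonincreasing_is_cvgn.
  exact/nonincreasing_seqP.
by exists 0 => _ [k _ <-].
Qed.

(** [Psi] converges, being nonincreasing and bounded below, and [t k] is squeezed between 0 and the
    consecutive difference [Psi k - Psi k.+1]. *)
Lemma descent_cvg0 (Psi t : nat -> R) :
  (forall k, 0 <= Psi k) -> (forall k, 0 <= t k) ->
  (forall k, Psi k.+1 <= Psi k - t k) -> t @ \oo --> (0 : R).
Proof.
move=> P0 t0 Pd.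
have /cvg_ex[/= l Pl] : cvgn Psi.
  by apply: nonincreasing_nonneg_cvg => // k; have := Pd k; have := t0 k; lra.
apply: (@squeeze_cvgr _ _ _ _ (fun=> 0) (fun k => Psi k - Psi k.+1)).
- by near=> k; rewrite t0 /=; have := Pd k; lra.
- exact: cvg_cst.
- rewrite -(subrr l); apply: cvgB => //.
  by rewrite (cvg_shiftS Psi).
Unshelve. all: by end_near.
Qed.

Lemma nonincreasing_subsequence_cvg0 (Psi : nat -> R) (f : nat -> nat) :
  (forall k, 0 <= Psi k) -> (forall k, Psi k.+1 <= Psi k) ->
  increasing_seq f -> Psi \o f @ \oo --> (0 : R) -> Psi @ \oo --> (0 : R).
Proof.
move=> P0 Pd fi Pf0.
have /cvg_ex[/= l Pl] := nonincreasing_nonneg_cvg P0 Pd.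
have Pfl : Psi \o f @ \oo --> l by apply: (cvg_comp f Psi (cvg_increasing fi)) Pl.
by rewrite (cvg_unique _ Pf0 Pfl).
Qed.

End Limits.

(** * Block vectors, their images in a common space, and block replacement *)

Section Blocks.
Context (R : realType) (n l : nat) (e : 'I_l -> nat).
Context (M : forall i, 'M[R]_(n, e i)).
Implicit Types (x : bvec R e).

(** Blocks have different dimensions, but their images all lie in ['cV[R]_n], where the energy
    estimates take place. *)
Definition block_img x (i : 'I_l) : 'cV[R]_n := M i *m submxcol x i.

Lemma mxrow_mul_blocks x : \mxrow_i M i *m x = \sum_i block_img x i.
Proof. by rewrite -{1}(submxcolK x) mul_mxrow_mxcol. Qed.

Lemma block_imgB x x' i : block_img (x - x') i = block_img x i - block_img x' i.
Proof. by rewrite /block_img submxcolB mulmxBr. Qed.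

Lemma submxcol_replace x i z k :
  submxcol (replace_block x (i := i) z) k = dfwith (submxcol x) i z k.
Proof. by rewrite mxcolK. Qed.

Lemma mxrow_mul_replace x i z :
  \mxrow_i M i *m replace_block x (i := i) z
  = \mxrow_i M i *m x + M i *m (z - submxcol x i).
Proof.
rewrite !mxrow_mul_blocks (bigD1 i) //= [in RHS](bigD1 i) //= mulmxBr.
rewrite /block_img submxcol_replace dfwithin [RHS]addrAC.
rewrite (addrC (M i *m submxcol x i)) subrK; congr (_ + _).
by apply: eq_bigr => k ki; rewrite submxcol_replace dfwithout // eq_sym.
Qed.

Lemma sum_replace (f : forall i, 'cV[R]_(e i) -> R) x i z :
  \sum_k f k (submxcol (replace_block x (i := i) z) k)
  = f i z + \sum_(k | k != i) f k (submxcol x k).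
Proof.
rewrite (bigD1 i) //= submxcol_replace dfwithin; congr (_ + _).
by apply: eq_bigr => k ki; rewrite submxcol_replace dfwithout // eq_sym.
Qed.

End Blocks.

(** * Optimality of the block subproblems and the set [Mstar] *)

Lemma eq_argmin (R : realType) (T : Type) (D : set T) (F G : T -> R) z :
  F =1 G -> argmin D F z -> argmin D G z.
Proof. by move=> /funext ->. Qed.

Section Problem.
Context (R : realType) (n p q : nat) (m : 'I_p -> nat) (d : 'I_q -> nat).
Context (P : problem R n m d).
Implicit Types (x : bvec R m) (y : bvec R d) (w ws : wvec R n m d).

Local Notation img_A := (block_img (mat_A P)).
Local Notation img_B := (block_img (mat_B P)).

Lemma residualB x x' y y' : residual P x y - residual P x' y' =
  \sum_i img_A (x - x') i + \sum_j img_B (y - y') j.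
Proof.
rewrite -!mxrow_mul_blocks /residual /Aall /Ball !mulmxBr.
by apply/colP => i; rewrite !mxE; ring.
Qed.

(** Moving only block [i] shifts the residual by [A_i (z - x_i)] and leaves the other objective
    terms constant, so [proximal_variational] applies. *)
Lemma x_subproblem_variational beta sigma x y lam i z0 z :
  convex_set (set_X P i) -> convex_function setT (obj_f P i) ->
  argmin (set_X P i)
    (fun z => auglag P beta (replace_block x z) y lam
       + sigma * beta / 2 * enorm (mat_A P i *m (z - submxcol x i)) ^+ 2) z0 ->
  set_X P i z ->
  0 <= obj_f P i z - obj_f P i z0 + inner (mat_A P i *m (z - z0))
    (beta *: (residual P x y + (1 + sigma) *: (mat_A P i *m (z0 - submxcol x i)))
     - lam).
Proof.
move=> cX cf zmin; apply: (proximal_variational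
  (C := \sum_(k | k != i) obj_f P k (submxcol x k)
        + \sum_j obj_g P j (submxcol y j)) cX cf).
apply: eq_argmin zmin => t; rewrite /auglag /h sum_replace !enorm_sqr.
have -> : residual P (replace_block x t) y =
    residual P x y + mat_A P i *m (t - submxcol x i).
  rewrite /residual /Aall mxrow_mul_replace [RHS]addrAC.
  by congr (_ - _); rewrite addrAC.
by ring.
Qed.

Lemma y_subproblem_variational beta sigma x y lam j z0 z :
  convex_set (set_Y P j) -> convex_function setT (obj_g P j) ->
  argmin (set_Y P j)
    (fun z => auglag P beta x (replace_block y z) lam
       + sigma * beta / 2 * enorm (mat_B P j *m (z - submxcol y j)) ^+ 2) z0 ->
  set_Y P j z ->
  0 <= obj_g P j z - obj_g P j z0 + inner (mat_B P j *m (z - z0))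
    (beta *: (residual P x y + (1 + sigma) *: (mat_B P j *m (z0 - submxcol y j)))
     - lam).
Proof.
move=> cY cg zmin; apply: (proximal_variational
  (C := \sum_i obj_f P i (submxcol x i)
        + \sum_(k | k != j) obj_g P k (submxcol y k)) cY cg).
apply: eq_argmin zmin => t; rewrite /auglag /h sum_replace !enorm_sqr.
have -> : residual P x (replace_block y t) =
    residual P x y + mat_B P j *m (t - submxcol y j).
  by rewrite /residual /Ball mxrow_mul_replace addrA [RHS]addrAC.
by ring.
Qed.

Lemma inner_J w ws : inner (w - ws) (J P ws) =
  inner (wl w - wl ws) (residual P (wx ws) (wy ws))
  - inner (\sum_i img_A (wx w - wx ws) i + \sum_j img_B (wy w - wy ws) j) (wl ws).
Proof.
rewrite /J /wtriple -(vsubmxK (w - ws)) -(vsubmxK (dsubmx (w - ws))).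
rewrite !inner_col_mx !linearB /= -/(wx w) -/(wx ws) -/(wy w) -/(wy ws)
  -/(wl w) -/(wl ws).
by rewrite -!mxrow_mul_blocks !innerNr -!inner_mulmxl !innerDl /Aall /Ball; ring.
Qed.

Lemma wtripleK x y (lam : 'cV[R]_n) :
  (wx (wtriple x y lam) = x) * (wy (wtriple x y lam) = y)
  * (wl (wtriple x y lam) = lam).
Proof. by rewrite /wx /wy /wl /wtriple !(col_mxKu, col_mxKd). Qed.

Lemma Mstar_residual ws : Mstar P ws -> residual P (wx ws) (wy ws) = 0.
Proof.
(* The multiplier component is unconstrained; moving it by minus the residual turns the inequality
   into [- |residual|^2 >= 0]. *)
move=> [[Xs Ys] /(_ (wtriple (wx ws) (wy ws)
  (wl ws - residual P (wx ws) (wy ws))))].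
rewrite /Mall /= inner_J !wtripleK !subrr.
rewrite -!mxrow_mul_blocks !mulmx0 addr0 inner0l subr0 add0r addrAC subrr add0r.
move=> /(_ (conj Xs Ys)); rewrite innerNl oppr_ge0; exact: inner_eq0.
Qed.

Lemma Mstar_variational ws x y : Mstar P ws -> Xall P x -> Yall P y ->
  0 <= h P x y - h P (wx ws) (wy ws) - inner (residual P x y) (wl ws).
Proof.
move=> Ms Xx Yy; have [_ /(_ (wtriple x y (wl ws)))] := Ms.
rewrite /Mall /= inner_J !wtripleK => /(_ (conj Xx Yy)).
by rewrite -residualB (Mstar_residual Ms) subr0 subrr inner0l sub0r.
Qed.

(** The variational inequality separates over the blocks once the residual vanishes, so blockwise
    inequalities, the form that survives the limit, are enough. *)
Lemma Mstar_intro ws : Mall P ws -> residual P (wx ws) (wy ws) = 0 ->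
  (forall i z, set_X P i z -> 0 <= obj_f P i z - obj_f P i (submxcol (wx ws) i)
     + inner (mat_A P i *m (z - submxcol (wx ws) i)) (- wl ws)) ->
  (forall j z, set_Y P j z -> 0 <= obj_g P j z - obj_g P j (submxcol (wy ws) j)
     + inner (mat_B P j *m (z - submxcol (wy ws) j)) (- wl ws)) ->
  Mstar P ws.
Proof.
move=> Ms r0 vx vy; split=> // w [Xw Yw].
have : 0 <= \sum_i (obj_f P i (submxcol (wx w) i)
    - obj_f P i (submxcol (wx ws) i) + inner (img_A (wx w - wx ws) i) (- wl ws)).
  by apply: sumr_ge0 => i _; rewrite /block_img submxcolB; exact: vx.
have : 0 <= \sum_j (obj_g P j (submxcol (wy w) j)
    - obj_g P j (submxcol (wy ws) j) + inner (img_B (wy w - wy ws) j) (- wl ws)).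
  by apply: sumr_ge0 => j _; rewrite /block_img submxcolB; exact: vy.
rewrite inner_J r0 (innerC _ 0) inner0l sub0r !big_split /= -!inner_suml !sumrN.
rewrite innerDl !innerNr /h; lra.
Qed.

End Problem.

(** * Bounds and limits recovered from block images through full column rank *)

Section BlockLimits.
Context (R : realType) (n l : nat) (e : 'I_l -> nat).
Context (M : forall i, 'M[R]_(n, e i)) (hM : forall i, \rank (M i) = e i).

Lemma full_col_rank_left_inverse i : exists B, B *m M i = 1%:M.
Proof. by apply/row_fullP; rewrite /row_full hM. Qed.

(** [tagnat.sig1] and [tagnat.sig2] decode a flat index into its block and its position within the
    block. *)
Lemma bvec_coord (x : bvec R e) c :
  x c 0 = submxcol x (tagnat.sig1 c) (tagnat.sig2 c) 0.
Proof. by rewrite -{1}(submxcolK x) mxE. Qed.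

(** A left inverse of [M i] recovers the block from its image, so bounds on images pass to
    coordinates. *)
Lemma bounded_block_img (x : nat -> bvec R e) C :
  (forall k, \sum_i inner (block_img M (x k) i) (block_img M (x k) i) <= C) ->
  forall c, exists C', forall k, `|x k c 0| <= C'.
Proof.
move=> xC c; have [B BM] := full_col_rank_left_inverse (tagnat.sig1 c).
have [|C' H] := @bounded_mulmx R _ _ B
  (fun k => block_img M (x k) (tagnat.sig1 c)) C _ (tagnat.sig2 c).
  move=> k; apply: le_trans (xC k); rewrite (bigD1 (tagnat.sig1 c)) //=.
  by rewrite lerDl sumr_ge0 // => i _; exact: inner_ge0.
exists C' => k; rewrite bvec_coord; move: (H k).
by rewrite /block_img mulmxA BM mul1mx.
Qed.

Lemma cvg_block_img_each (x : nat -> bvec R e) :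
  (fun k => \sum_i inner (block_img M (x k) i) (block_img M (x k) i)) @ \oo
    --> (0 : R) ->
  forall i, (fun k => block_img M (x k) i) @ \oo --> (0 : 'cV[R]_n).
Proof.
move=> x0 i; apply: cvg0_of_inner; apply: (cvg0_of_le ltr01) x0 => k.
  exact: inner_ge0.
rewrite mul1r (bigD1 i) //= lerDl sumr_ge0 // => j _; exact: inner_ge0.
Qed.

Lemma cvg_block_img_sum (x : nat -> bvec R e) :
  (fun k => \sum_i inner (block_img M (x k) i) (block_img M (x k) i)) @ \oo
    --> (0 : R) ->
  (fun k => \sum_i block_img M (x k) i) @ \oo --> (0 : 'cV[R]_n).
Proof.
by move=> /cvg_block_img_each /cvg_sum; rewrite big1_eq.
Qed.

Lemma cvg0_of_block_img (x : nat -> bvec R e) :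
  (fun k => \sum_i inner (block_img M (x k) i) (block_img M (x k) i)) @ \oo
    --> (0 : R) ->
  x @ \oo --> (0 : bvec R e).
Proof.
move=> /cvg_block_img_each x0; apply/cvg_colP => c; rewrite mxE.
have [B BM] := full_col_rank_left_inverse (tagnat.sig1 c).
have /cvg_colP/(_ (tagnat.sig2 c)) := cvg_mulmx (A := B) (x0 (tagnat.sig1 c)).
rewrite mulmx0 mxE; apply: cvg_trans; apply: near_eq_cvg.
by near=> k; rewrite /block_img mulmxA BM mul1mx -bvec_coord.
Unshelve. all: by end_near.
Qed.

Lemma cvg_submxcol (x : nat -> bvec R e) (a : bvec R e) i :
  x @ \oo --> a -> (fun k => submxcol (x k) i) @ \oo --> submxcol a i.
Proof.
move=> /cvg_colP xa; apply/cvg_colP => c; rewrite !mxE.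
under eq_cvg do rewrite mxE.
  exact: xa.
Qed.

Lemma cvg_block_quad0 (x : nat -> bvec R e) c kappa :
  x @ \oo --> (0 : bvec R e) ->
  (fun k => block_quad c kappa (block_img M (x k))) @ \oo --> (0 : R).
Proof.
move=> x0.
have u0 i : (fun k => block_img M (x k) i) @ \oo --> (0 : 'cV[R]_n).
  rewrite -(mulmx0 _ (M i)); apply: cvg_mulmx.
  have -> : (0 : 'cV[R]_(e i)) = submxcol (0 : bvec R e) i by rewrite submxcol0.
  exact: cvg_submxcol.
have -> : 0 = c * (\sum_(i < l) inner (0 : 'cV[R]_n) 0)
    - kappa * inner (\sum_(i < l) (0 : 'cV[R]_n)) (\sum_(i < l) (0 : 'cV[R]_n)).
  by rewrite !big1 ?inner0l ?mulr0 ?subrr // => i _; rewrite inner0l.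
apply: cvgB; apply: cvgM; try exact: cvg_cst.
  by apply: cvg_sum => i; apply: cvg_inner.
by apply: cvg_inner; apply: cvg_sum.
Qed.

End BlockLimits.

(** * Passage to the limit in variational inequalities and stacked vectors *)

(** The inequality says that [(u k, f z + <A (z - u k), g k>)] lies in the epigraph of [f]. These
    points converge and the epigraph is closed, so continuity of [f] is not invoked. *)
Lemma variational_limit (R : realType) n N (f : 'cV[R]_N -> R)
    (A : 'M[R]_(n, N)) (z : 'cV[R]_N) (u : nat -> 'cV[R]_N) (a : 'cV[R]_N)
    (g : nat -> 'cV[R]_n) (b : 'cV[R]_n) :
  closed [set z : 'cV[R]_N * R | f z.1 <= z.2] ->
  u @ \oo --> a -> g @ \oo --> b ->
  (forall k, 0 <= f z - f (u k) + inner (A *m (z - u k)) (g k)) ->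
  0 <= f z - f a + inner (A *m (z - a)) b.
Proof.
move=> cf ua gb H.
suff : f a <= f z + inner (A *m (z - a)) b by lra.
apply: (@closed_cvg _ _ \oo _
  (fun k => (u k, f z + inner (A *m (z - u k)) (g k)))
  (fun t : 'cV[R]_N * R => f t.1 <= t.2) cf
  _ (a, f z + inner (A *m (z - a)) b)).
  by near=> k => /=; have := H k; lra.
apply: (@cvg_pair _ _ _ \oo (nbhs a) (nbhs (f z + inner (A *m (z - a)) b))) => //.
apply: cvgD; first exact: cvg_cst.
apply: cvg_inner => //; apply: cvg_mulmx; apply: cvgB => //; exact: cvg_cst.
Unshelve. all: by end_near.
Qed.

Section ProblemLimits.
Context (R : realType) (n p q : nat) (m : 'I_p -> nat) (d : 'I_q -> nat).
Context (P : problem R n m d).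

Lemma wtriple_eta (w : wvec R n m d) : w = wtriple (wx w) (wy w) (wl w).
Proof. by rewrite /wtriple /wx /wy /wl !vsubmxK. Qed.

Lemma cvg_wtriple (x : nat -> bvec R m) (y : nat -> bvec R d)
    (lam : nat -> 'cV[R]_n)
    (a : bvec R m) (b : bvec R d) (c : 'cV[R]_n) :
  x @ \oo --> a -> y @ \oo --> b -> lam @ \oo --> c ->
  (fun k => wtriple (x k) (y k) (lam k)) @ \oo --> wtriple a b c.
Proof.
move=> /cvg_colP xa /cvg_colP yb /cvg_colP lc; apply/cvg_colP => i.
rewrite /wtriple; case: (split_ordP i) => j ->.
  rewrite col_mxEu; under eq_cvg do rewrite col_mxEu.
  exact: xa.
case: (split_ordP j) => k ->.
  rewrite col_mxEd col_mxEu; under eq_cvg do rewrite col_mxEd col_mxEu.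
  exact: yb.
rewrite !col_mxEd; under eq_cvg do rewrite !col_mxEd.
exact: lc.
Qed.

Lemma bounded_wtriple_subsequence (w : nat -> wvec R n m d) :
  (forall i, exists C, forall k, `|wx (w k) i 0| <= C) ->
  (forall i, exists C, forall k, `|wy (w k) i 0| <= C) ->
  (forall i, exists C, forall k, `|wl (w k) i 0| <= C) ->
  exists2 f : nat -> nat, increasing_seq f &
    exists a : wvec R n m d, w \o f @ \oo --> a.
Proof.
move=> bx by_ bl; apply: bounded_col_subsequence => i.
case: (split_ordP i) => j ->.
  have [C H] := bx j; exists C => k.
  by rewrite (wtriple_eta (w k)) /wtriple col_mxEu.
case: (split_ordP j) => c ->.
  have [C H] := by_ c; exists C => k.
  by rewrite (wtriple_eta (w k)) /wtriple col_mxEd col_mxEu.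
have [C H] := bl c; exists C => k.
by rewrite (wtriple_eta (w k)) /wtriple !col_mxEd.
Qed.

Lemma cvg_wx (w : nat -> wvec R n m d) (a : wvec R n m d) :
  w @ \oo --> a -> (fun k => wx (w k)) @ \oo --> wx a.
Proof.
move=> /cvg_colP wa; apply/cvg_colP => i; rewrite mxE.
under eq_cvg do rewrite mxE.
  exact: wa.
Qed.

Lemma cvg_wy (w : nat -> wvec R n m d) (a : wvec R n m d) :
  w @ \oo --> a -> (fun k => wy (w k)) @ \oo --> wy a.
Proof.
move=> /cvg_colP wa; apply/cvg_colP => i; rewrite !mxE.
under eq_cvg do rewrite !mxE.
  exact: wa.
Qed.

Lemma cvg_wl (w : nat -> wvec R n m d) (a : wvec R n m d) :
  w @ \oo --> a -> (fun k => wl (w k)) @ \oo --> wl a.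
Proof.
move=> /cvg_colP wa; apply/cvg_colP => i; rewrite !mxE.
under eq_cvg do rewrite !mxE.
  exact: wa.
Qed.

Lemma cvg_residual (x : nat -> bvec R m) (y : nat -> bvec R d)
    (a : bvec R m) (b : bvec R d) :
  x @ \oo --> a -> y @ \oo --> b ->
  (fun k => residual P (x k) (y k)) @ \oo --> residual P a b.
Proof.
move=> xa yb; apply: cvgB; last exact: cvg_cst.
by apply: cvgD; apply: cvg_mulmx.
Qed.

End ProblemLimits.

(** * One GS-ADMM iteration: optimality conditions of the updates *)

(** Blocks updated in parallel share [r] and [lam], so their conditions add up. The sign [o] is 1 or
    -1 according to whether [u] points towards or away from the test point. *)
Lemma sum_variational_ge0 (R : realType) n l (a a' : 'I_l -> R)
    (u e : 'I_l -> 'cV[R]_n) r lam b c o :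
  (forall i, 0 <= a i - a' i + o * inner (u i) (b *: (r + c *: e i) - lam)) ->
  0 <= \sum_i a i - \sum_i a' i
    + o * (inner (\sum_i u i) (b *: r - lam)
           + b * (c * \sum_i inner (u i) (e i))).
Proof.
move=> H; rewrite inner_suml !mulr_sumr -big_split mulr_sumr -sumrB -big_split.
apply: sumr_ge0 => i _ /=; apply: le_trans (H i) _.
by rewrite !innerE; lra.
Qed.

Lemma block_img_subB (R : realType) n l (e : 'I_l -> nat)
    (M : forall i, 'M[R]_(n, e i)) (a b c : bvec R e) :
  (fun i => block_img M (a - c) i - block_img M (b - c) i) = block_img M (a - b).
Proof.
by apply/funext => i; rewrite -block_imgB opprB addrA subrK.
Qed.

Lemma sum_block_img_subB (R : realType) n l (e : 'I_l -> nat)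
    (M : forall i, 'M[R]_(n, e i)) (a b c : bvec R e) :
  \sum_i block_img M (a - b) i
  = \sum_i block_img M (a - c) i - \sum_i block_img M (b - c) i.
Proof. by rewrite -(block_img_subB M a b c) sumrB. Qed.

Section Iteration.
Context (R : realType) (n p q : nat) (m : 'I_p -> nat) (d : 'I_q -> nat).
Context (P : problem R n m d).
Context (hf : forall i, closed_proper_convex (obj_f P i))
    (hg : forall j, closed_proper_convex (obj_g P j))
    (hX : forall i, closed (set_X P i) /\ convex_set (set_X P i))
    (hY : forall j, closed (set_Y P j) /\ convex_set (set_Y P j)).
Context (beta sigma1 sigma2 tau s : R) (hbeta : 0 < beta)
    (hsigma1 : p%:R - 1 < sigma1) (hsigma2 : q%:R - 1 < sigma2)
    (hK : Kset (tau, s)).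
Context (w : nat -> wvec R n m d) (hw : GS_ADMM P beta sigma1 sigma2 tau s w).

Local Notation x k := (wx (w k)).
Local Notation y k := (wy (w k)).
Local Notation lam k := (wl (w k)).
Local Notation res k := (residual P (x k) (y k)).
Local Notation mid_res k := (residual P (x k.+1) (y k)).
Local Notation dx k := (block_img (mat_A P) (x k.+1 - x k)).
Local Notation dy k := (block_img (mat_B P) (y k.+1 - y k)).

Lemma Mall_iter k : Mall P (w k).
Proof.
case: k => [|k]; first exact: hw.1.
by have [hx hy _] := hw.2 k; split=> i; [exact: (hx i).1|exact: (hy i).1].
Qed.

Lemma lam_iter k : lam k.+1 =
  lam k - (tau * beta) *: mid_res k - (s * beta) *: res k.+1.
Proof. by have [_ _ ->] := hw.2 k. Qed.

Lemma x_iter_variational k i z : set_X P i z ->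
  0 <= obj_f P i z - obj_f P i (submxcol (x k.+1) i)
   + inner (mat_A P i *m (z - submxcol (x k.+1) i))
       (beta *: (res k + (1 + sigma1) *: dx k i) - lam k).
Proof.
have [hx _ _] := hw.2 k; rewrite /block_img submxcolB.
exact: (x_subproblem_variational (hX i).2 (hf i).2 (hx i)).
Qed.

Lemma y_iter_variational k j z : set_Y P j z ->
  0 <= obj_g P j z - obj_g P j (submxcol (y k.+1) j)
   + inner (mat_B P j *m (z - submxcol (y k.+1) j))
       (beta *: (mid_res k + (1 + sigma2) *: dy k j)
        - lam_half P beta tau w k).
Proof.
have [_ hy _] := hw.2 k; rewrite /block_img submxcolB.
exact: (y_subproblem_variational (hY j).2 (hg j).2 (hy j)).
Qed.

(** * Energy estimates along the iterates, relative to a point of [Mstar] *)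

Local Notation dev_x ws k := (block_img (mat_A P) (x k - wx ws)).
Local Notation dev_y ws k := (block_img (mat_B P) (y k - wy ws)).
Local Notation dev_lam ws k := (beta^-1 *: (lam k - wl ws)).

Definition iter_energy ws k :=
  energy sigma1 sigma2 tau s (dev_x ws k) (dev_y ws k) (dev_lam ws k).

Lemma residual_dev ws a b : Mstar P ws ->
  residual P (x a) (y b) = \sum_i dev_x ws a i + \sum_j dev_y ws b j.
Proof. by move=> Ms; rewrite -residualB (Mstar_residual Ms) subr0. Qed.

(** The block conditions tested at [ws] are added to the inequality of [ws] tested at the new
    iterate. All objective values cancel. *)
Lemma iter_variational ws k : Mstar P ws ->
  0 <= inner (res k.+1) (dev_lam ws k - mid_res k)
   - ((1 + sigma1) * (\sum_i inner (dev_x ws k.+1 i) (dx k i))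
      - inner (\sum_i dev_x ws k.+1 i) (\sum_i dx k i))
   - tau * inner (\sum_j dev_y ws k.+1 j) (mid_res k)
   - (1 + sigma2) * (\sum_j inner (dev_y ws k.+1 j) (dy k j)).
Proof.
move=> Ms; have [[Xs Ys] _] := Ms; have [Xw Yw] := Mall_iter k.+1.
have := Mstar_variational Ms Xw Yw.
have /sum_variational_ge0 Hx : forall i, 0 <= obj_f P i (submxcol (wx ws) i)
    - obj_f P i (submxcol (x k.+1) i) + -1 * inner (dev_x ws k.+1 i)
        (beta *: (res k + (1 + sigma1) *: dx k i) - lam k).
  move=> i; rewrite mulN1r -innerNl {1}/block_img -mulmxN.
  by rewrite submxcolB opprB; exact: x_iter_variational.
have /sum_variational_ge0 Hy : forall j, 0 <= obj_g P j (submxcol (wy ws) j)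
    - obj_g P j (submxcol (y k.+1) j) + -1 * inner (dev_y ws k.+1 j)
        (beta *: (mid_res k + (1 + sigma2) *: dy k j)
         - lam_half P beta tau w k).
  move=> j; rewrite mulN1r -innerNl {1}/block_img -mulmxN.
  by rewrite submxcolB opprB; exact: y_iter_variational.
move: Hx Hy; rewrite /h /lam_half !mulN1r.
have -> : \sum_i dx k i = \sum_i dev_x ws k.+1 i - \sum_i dev_x ws k i.
  exact: sum_block_img_subB.
rewrite !(residual_dev _ _ Ms).
move: (\sum_i dev_x ws k.+1 i) (\sum_i dev_x ws k i) => U' U.
move: (\sum_j dev_y ws k.+1 j) (\sum_j dev_y ws k j) => V' V.
have : lam k = beta *: dev_lam ws k + wl ws.
  by rewrite scalerA mulfV ?gt_eqF // scale1r subrK.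
move: (dev_lam ws k) => nu ->; move: (wl ws) => ls.
move: (\sum_i inner _ _) (\sum_j inner _ _) => a b.
move: (\sum_i obj_f P i (submxcol (wx ws) i))
  (\sum_i obj_f P i (submxcol (x k.+1) i)) => f0 f1.
move: (\sum_j obj_g P j (submxcol (wy ws) j))
  (\sum_j obj_g P j (submxcol (y k.+1) j)) => g0 g1 Hx Hy Hh.
(* The claim is scaled by [beta] to match the sum of the three inequalities. *)
rewrite -(pmulr_rge0 _ hbeta).
apply: le_trans (addr_ge0 (addr_ge0 Hx Hy) Hh) _.
by rewrite !innerE; lra.
Qed.

Lemma iter_energy_step ws k : Mstar P ws ->
  iter_energy ws k.+1 <= iter_energy ws k
    - block_quad (1 + sigma1) 1 (dx k) - block_quad (1 + sigma2) tau (dy k)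
    - (2 - tau - s) * inner (res k.+1) (res k.+1)
    + 2 * (1 - tau) * inner (res k.+1) (\sum_j dy k j).
Proof.
move=> Ms; have [ts _ _ _] := Kset_bounds hK.
rewrite -(block_img_subB _ (x k.+1) (x k) (wx ws)).
rewrite -(block_img_subB _ (y k.+1) (y k) (wy ws)).
apply: (energy_step (rho := mid_res k)) => //.
- exact: residual_dev.
- exact: residual_dev.
- rewrite lam_iter; apply/colP => i; rewrite !mxE; field; rewrite gt_eqF //.
- have := iter_variational k Ms.
  rewrite -(block_img_subB _ (x k.+1) (x k) (wx ws)).
  by rewrite -(block_img_subB _ (y k.+1) (y k) (wy ws)).
Qed.

Lemma mid_residualE k : mid_res k = res k.+1 - \sum_j dy k j.
Proof.
rewrite -mxrow_mul_blocks mulmxBr /residual /Ball.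
by apply/colP => i; rewrite !mxE; ring.
Qed.

(** The y-condition of step [k+1] is tested at [y k.+1] and that of step [k] at [y k.+2], so the
    objective values cancel. The two half-step multipliers differ by [- s beta res k.+1 - tau beta
    mid_res k.+1]. *)
Lemma iter_cross_term k :
  2 * (1 + tau) * inner (res k.+2) (\sum_j dy k.+1 j) <=
    2 * (1 - s) * inner (res k.+1) (\sum_j dy k.+1 j)
    + 2 * tau * inner (\sum_j dy k.+1 j) (\sum_j dy k.+1 j)
    - block_quad (1 + sigma2) 1 (dy k.+1) + block_quad (1 + sigma2) 1 (dy k).
Proof.
apply: cross_term_le => //.
have /sum_variational_ge0 Hy' : forall j, 0 <= obj_g P j (submxcol (y k.+1) j)
    - obj_g P j (submxcol (y k.+2) j) + -1 * inner (dy k.+1 j)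
        (beta *: (mid_res k.+1 + (1 + sigma2) *: dy k.+1 j)
         - lam_half P beta tau w k.+1).
  move=> j; rewrite mulN1r -innerNl {1}/block_img -mulmxN.
  rewrite submxcolB opprB; apply: y_iter_variational.
  exact: (Mall_iter k.+1).2.
have /sum_variational_ge0 Hy : forall j, 0 <= obj_g P j (submxcol (y k.+2) j)
    - obj_g P j (submxcol (y k.+1) j) + 1 * inner (dy k.+1 j)
        (beta *: (mid_res k + (1 + sigma2) *: dy k j)
         - lam_half P beta tau w k).
  move=> j; rewrite mul1r {1}/block_img submxcolB.
  by apply: y_iter_variational; exact: (Mall_iter k.+2).2.
move: Hy' Hy; rewrite mul1r mulN1r.
have -> : \sum_j inner (dy k.+1 j) (dy k.+1 j - dy k j) =
    \sum_j inner (dy k.+1 j) (dy k.+1 j) - \sum_j inner (dy k.+1 j) (dy k j).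
  by rewrite -sumrB; apply: eq_bigr => j _; rewrite innerDr innerNr.
rewrite /lam_half lam_iter.
rewrite !mid_residualE.
move: (\sum_j dy k.+1 j) (\sum_j dy k j) => E' E.
move: (\sum_j inner _ _) (\sum_j inner _ _) => a b.
move: (\sum_j obj_g P j (submxcol (y k.+1) j))
  (\sum_j obj_g P j (submxcol (y k.+2) j)) => g1 g2 Hy' Hy.
rewrite -(pmulr_rge0 _ hbeta).
apply: le_trans (addr_ge0 Hy' Hy) _.
by rewrite !innerE; lra.
Qed.

(** * The Lyapunov function, its decrease and its coercivity *)

Local Notation kappa := ((1 - s) ^+ 2 / (1 + tau)).
Local Notation theta := ((1 - tau) / (1 + tau)).

(** The energy is taken at [k.+1] because the added term needs [dy k], the increment that led to
    that iterate. *)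
Definition lyapunov ws k :=
  iter_energy ws k.+1 + kappa * inner (res k.+1) (res k.+1)
  + theta * block_quad (1 + sigma2) 1 (dy k).

Lemma lyapunov_decrease ws k : Mstar P ws ->
  lyapunov ws k.+1 <= lyapunov ws k
    - (block_quad (1 + sigma1) 1 (dx k.+1) + block_quad (1 + sigma2) 1 (dy k.+1)
       + (2 - tau - s - kappa) * inner (res k.+2) (res k.+2)).
Proof.
move=> Ms; rewrite /lyapunov.
have := energy_decrease hK erefl erefl (iter_energy_step k.+1 Ms)
  (iter_cross_term k).
by rewrite !opprD !addrA.
Qed.

Lemma lyapunov_ge ws k :
  (1 + sigma1 - p%:R) * (\sum_i inner (dev_x ws k.+1 i) (dev_x ws k.+1 i))
  + (1 + sigma2 - q%:R) * (\sum_j inner (dev_y ws k.+1 j) (dev_y ws k.+1 j))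
  + (tau + s)^-1 * inner (dev_lam ws k.+1 - tau *: \sum_j dev_y ws k.+1 j)
                         (dev_lam ws k.+1 - tau *: \sum_j dev_y ws k.+1 j)
  <= lyapunov ws k.
Proof.
have [_ t1 t0 _] := Kset_bounds hK.
have := block_quad_ge sigma1 (dev_x ws k.+1) (lexx 1).
have := block_quad_ge sigma2 (dev_y ws k.+1) t1.
have : 0 <= theta * block_quad (1 + sigma2) 1 (dy k).
  by rewrite mulr_ge0 ?block_quad_ge0 // divr_ge0 ?subr_ge0 // ltW.
have : 0 <= kappa * inner (res k.+1) (res k.+1).
  by rewrite mulr_ge0 ?inner_ge0 // divr_ge0 ?sqr_ge0 // ltW.
rewrite /lyapunov /iter_energy /energy; lra.
Qed.

Let x_gap : 0 < 1 + sigma1 - p%:R. Proof. by move: hsigma1; lra. Qed.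
Let y_gap : 0 < 1 + sigma2 - q%:R. Proof. by move: hsigma2; lra. Qed.
Let lam_gap : 0 < (tau + s)^-1.
Proof. by have [ts _ _ _] := Kset_bounds hK; rewrite invr_gt0. Qed.

Let sum_inner_ge0 l (u : 'I_l -> 'cV[R]_n) : 0 <= \sum_i inner (u i) (u i).
Proof. by apply: sumr_ge0 => i _; exact: inner_ge0. Qed.

Lemma lyapunov_ge_parts ws k :
  [/\ (1 + sigma1 - p%:R) * (\sum_i inner (dev_x ws k.+1 i) (dev_x ws k.+1 i))
        <= lyapunov ws k,
      (1 + sigma2 - q%:R) * (\sum_j inner (dev_y ws k.+1 j) (dev_y ws k.+1 j))
        <= lyapunov ws k,
      (tau + s)^-1 * inner (dev_lam ws k.+1 - tau *: \sum_j dev_y ws k.+1 j)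
                         (dev_lam ws k.+1 - tau *: \sum_j dev_y ws k.+1 j)
        <= lyapunov ws k
    & 0 <= lyapunov ws k].
Proof.
have := lyapunov_ge ws k.
have := mulr_ge0 (ltW x_gap) (sum_inner_ge0 (dev_x ws k.+1)).
have := mulr_ge0 (ltW y_gap) (sum_inner_ge0 (dev_y ws k.+1)).
have := mulr_ge0 (ltW lam_gap)
  (inner_ge0 (dev_lam ws k.+1 - tau *: \sum_j dev_y ws k.+1 j)).
by move=> *; split; lra.
Qed.

(** The guaranteed decrease of [lyapunov] from [k] to [k.+1]; it does not depend on the center
    [ws]. *)
Let gap k := block_quad (1 + sigma1) 1 (dx k.+1)
  + block_quad (1 + sigma2) 1 (dy k.+1)
  + (2 - tau - s - kappa) * inner (res k.+2) (res k.+2).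

Lemma gap_ge_parts k :
  [/\ (1 + sigma1 - p%:R) * (\sum_i inner (dx k.+1 i) (dx k.+1 i)) <= gap k,
      (1 + sigma2 - q%:R) * (\sum_j inner (dy k.+1 j) (dy k.+1 j)) <= gap k,
      (2 - tau - s - kappa) * inner (res k.+2) (res k.+2) <= gap k
    & 0 <= gap k].
Proof.
have [_ _ _ eta0] := Kset_bounds hK.
have := block_quad_ge sigma1 (dx k.+1) (lexx 1).
have := block_quad_ge sigma2 (dy k.+1) (lexx 1).
have := mulr_ge0 (ltW x_gap) (sum_inner_ge0 (dx k.+1)).
have := mulr_ge0 (ltW y_gap) (sum_inner_ge0 (dy k.+1)).
have := mulr_ge0 (ltW eta0) (inner_ge0 (res k.+2)).
by rewrite /gap => *; split; lra.
Qed.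

Lemma lyapunov_nonincreasing ws k : Mstar P ws ->
  lyapunov ws k.+1 <= lyapunov ws k.
Proof.
move=> Ms; have := lyapunov_decrease k Ms.
by have [_ _ _] := gap_ge_parts k; rewrite /gap; lra.
Qed.

(** * Vanishing increments and residuals *)

Context (hMstar : Mstar P !=set0).

Let gap_cvg0 : gap @ \oo --> (0 : R).
Proof.
have [ws Ms] := hMstar; apply: (@descent_cvg0 _ (lyapunov ws)) => k.
- by have [] := lyapunov_ge_parts ws k.
- by have [] := gap_ge_parts k.
- exact: lyapunov_decrease.
Qed.

Lemma dx_cvg0 : (fun k => \sum_i inner (dx k i) (dx k i)) @ \oo --> (0 : R).
Proof.
(* [gap k] controls the increment [dx k.+1], hence the shift by one. *)
rewrite -cvg_shiftS; apply: (cvg0_of_le x_gap) gap_cvg0 => k; first exact: sum_inner_ge0.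
by have [] := gap_ge_parts k.
Qed.

Lemma dy_cvg0 : (fun k => \sum_j inner (dy k j) (dy k j)) @ \oo --> (0 : R).
Proof.
rewrite -cvg_shiftS; apply: (cvg0_of_le y_gap) gap_cvg0 => k; first exact: sum_inner_ge0.
by have [] := gap_ge_parts k.
Qed.

Lemma res_cvg0 : (fun k => res k) @ \oo --> (0 : 'cV[R]_n).
Proof.
have [_ _ _ eta0] := Kset_bounds hK; apply: cvg0_of_inner.
(* [gap k] controls [res k.+2], hence two shifts. *)
rewrite -cvg_shiftS -cvg_shiftS.
apply: (cvg0_of_le eta0) gap_cvg0 => k; first exact: inner_ge0.
by have [] := gap_ge_parts k.
Qed.

Lemma dx_each_cvg0 i : (fun k => dx k i) @ \oo --> (0 : 'cV[R]_n).
Proof. exact: (cvg_block_img_each dx_cvg0 i). Qed.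

Lemma dy_each_cvg0 j : (fun k => dy k j) @ \oo --> (0 : 'cV[R]_n).
Proof. exact: (cvg_block_img_each dy_cvg0 j). Qed.

Lemma res_succ_cvg0 : (fun k => res k.+1) @ \oo --> (0 : 'cV[R]_n).
Proof. by have := res_cvg0; rewrite -cvg_shiftS. Qed.

Lemma mid_res_cvg0 : (fun k => mid_res k) @ \oo --> (0 : 'cV[R]_n).
Proof.
rewrite (eq_cvg _ _ mid_residualE).
have := cvgB res_succ_cvg0 (cvg_block_img_sum dy_cvg0); rewrite subr0; exact.
Qed.

Lemma lyapunov_le0 ws k : Mstar P ws -> lyapunov ws k <= lyapunov ws 0.
Proof.
move=> Ms; elim: k => // k; apply: le_trans; exact: lyapunov_nonincreasing.
Qed.

(** * Cluster points and convergence of the whole sequence *)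

Context (hA : forall i, \rank (mat_A P i) = m i)
  (hB : forall j, \rank (mat_B P j) = d j).

(** [lyapunov ws k] dominates the deviations at iterate [k.+1] and never exceeds its initial value.
    Full column rank bounds [x] and [y]; the multiplier is recovered from bounds on [nu - tau V] and
    on [V]. *)
Lemma iter_subsequence : exists2 f : nat -> nat, increasing_seq f &
  exists winf : wvec R n m d, (fun k => w (f k).+1) @ \oo --> winf.
Proof.
have [ws Ms] := hMstar.
have bound k : lyapunov ws k <= lyapunov ws 0 by exact: lyapunov_le0.
have xC k : \sum_i inner (dev_x ws k.+1 i) (dev_x ws k.+1 i)
    <= (1 + sigma1 - p%:R)^-1 * lyapunov ws 0.
  rewrite mulrC ler_pdivlMr // mulrC; apply: le_trans (bound k).
  by have [] := lyapunov_ge_parts ws k.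
have yC k : \sum_j inner (dev_y ws k.+1 j) (dev_y ws k.+1 j)
    <= (1 + sigma2 - q%:R)^-1 * lyapunov ws 0.
  rewrite mulrC ler_pdivlMr // mulrC; apply: le_trans (bound k).
  by have [] := lyapunov_ge_parts ws k.
apply: (@bounded_wtriple_subsequence _ _ _ _ _ _ (fun k => w k.+1)) => i.
- have [C H] := bounded_block_img hA xC i; exists (C + `|wx ws i 0|) => k.
  rewrite -(subrK (wx ws i 0) (x k.+1 i 0)).
  apply: le_trans (ler_normD _ _) (lerD _ (lexx _)).
  by have := H k; rewrite !mxE.
- have [C H] := bounded_block_img hB yC i; exists (C + `|wy ws i 0|) => k.
  rewrite -(subrK (wy ws i 0) (y k.+1 i 0)).
  apply: le_trans (ler_normD _ _) (lerD _ (lexx _)).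
  by have := H k; rewrite !mxE.
pose V k := \sum_j dev_y ws k.+1 j.
have VC k : inner (V k) (V k)
    <= q%:R * ((1 + sigma2 - q%:R)^-1 * lyapunov ws 0).
  by apply: le_trans (ler_inner_sum _) _; apply: ler_wpM2l.
have DC k : inner (dev_lam ws k.+1 - tau *: V k) (dev_lam ws k.+1 - tau *: V k)
    <= (tau + s)^-1^-1 * lyapunov ws 0.
  rewrite mulrC ler_pdivlMr // mulrC; apply: le_trans (bound k).
  by have [] := lyapunov_ge_parts ws k.
(* With the identity matrix, a bound on the norm becomes a bound on each coordinate. *)
have [C1 H1] := bounded_mulmx 1%:M VC i.
have [C2 H2] := bounded_mulmx 1%:M DC i.
exists (`|beta| * (C2 + `|tau| * C1) + `|wl ws i 0|) => k.
have -> : lam k.+1 = beta *: ((dev_lam ws k.+1 - tau *: V k) + tau *: V k)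
    + wl ws.
  by rewrite subrK scalerA mulfV ?gt_eqF // scale1r subrK.
have := H1 k; have := H2 k; rewrite !mul1mx.
move: (dev_lam ws k.+1 - tau *: V k) => D; move: (V k) => V' h2 h1.
rewrite !mxE; apply: le_trans (ler_normD _ _) (lerD _ (lexx _)).
rewrite normrM ler_wpM2l //; apply: le_trans (ler_normD _ _) (lerD h2 _).
by rewrite normrM ler_wpM2l.
Qed.

(** In each block condition the vector paired with [A_i (z - x_i)] or [B_j (z - y_j)] is
    [- lam k.+1] plus multiples of residuals and increments. These vanish, so it tends to
    [- wl winf] along the subsequence. *)
Lemma iter_limit_Mstar (f : nat -> nat) (winf : wvec R n m d) :
  increasing_seq f -> (fun k => w (f k).+1) @ \oo --> winf -> Mstar P winf.
Proof.
move=> fi wf.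
have xf := cvg_wx wf; have yf := cvg_wy wf; have lf := cvg_wl wf.
(* Everything is expressed through [lam k.+1], the multiplier whose limit along [f] is known. *)
have opp_lam (v : nat -> 'cV[R]_n) (r : nat -> 'cV[R]_n) :
    r @ \oo --> (0 : 'cV[R]_n) -> (forall k, v k = r k - lam k.+1) ->
    (fun k => v (f k)) @ \oo --> - wl winf.
  move=> /(cvg_subsequence fi) r0 vE; under eq_cvg do rewrite vE.
  by rewrite -(sub0r (wl winf)); apply: cvgB.
apply: Mstar_intro.
- split=> i.
    have H : \forall k \near \oo, set_X P i (submxcol (x (f k).+1) i).
      by near=> k; exact: (Mall_iter (f k).+1).1.
    exact: (closed_cvg _ (hX i).1 H _ (cvg_submxcol xf)).
  have H : \forall k \near \oo, set_Y P i (submxcol (y (f k).+1) i).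
    by near=> k; exact: (Mall_iter (f k).+1).2.
  exact: (closed_cvg _ (hY i).1 H _ (cvg_submxcol yf)).
- apply: cvg_unique (cvg_residual xf yf) _; first exact: norm_hausdorff.
  exact: (cvg_subsequence fi res_succ_cvg0).
- move=> i z Xz; apply: (variational_limit (hf i).1 (cvg_submxcol xf)).
    apply: (opp_lam (fun k => beta *: (res k + (1 + sigma1) *: dx k i) - lam k)
      (fun k => beta *: (res k + (1 + sigma1) *: dx k i)
        + ((- (tau * beta)) *: mid_res k + (- (s * beta)) *: res k.+1))).
      apply: cvg0D; first apply: cvg0Z; apply: cvg0D.
      + exact: res_cvg0.
      + by apply: cvg0Z; exact: dx_each_cvg0.
      + by apply: cvg0Z; exact: mid_res_cvg0.
      + by apply: cvg0Z; exact: res_succ_cvg0.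
    move=> k; rewrite lam_iter.
    move: (_ *: (res k + _)) => a; move: (mid_res k) (res k.+1) => b c.
    by apply/colP => j; rewrite !mxE; ring.
  by move=> k /=; exact: x_iter_variational.
- move=> j z Yz; apply: (variational_limit (hg j).1 (cvg_submxcol yf)).
    apply: (opp_lam (fun k => beta *: (mid_res k + (1 + sigma2) *: dy k j)
        - lam_half P beta tau w k)
      (fun k => beta *: (mid_res k + (1 + sigma2) *: dy k j)
        + (- (s * beta)) *: res k.+1)).
      apply: cvg0D; first (apply: cvg0Z; apply: cvg0D).
      + exact: mid_res_cvg0.
      + by apply: cvg0Z; exact: dy_each_cvg0.
      + by apply: cvg0Z; exact: res_succ_cvg0.
    move=> k; rewrite lam_iter /lam_half.
    move: (_ *: (_ + _)) => a; move: (mid_res k) (res k.+1) => b c.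
    by apply/colP => i; rewrite !mxE; ring.
  by move=> k /=; exact: y_iter_variational.
Unshelve. all: by end_near.
Qed.

(** Since [winf] is in [Mstar], it may serve as center. Every term vanishes along the subsequence,
    and monotonicity extends this to the full sequence. *)
Lemma lyapunov_cvg0 (f : nat -> nat) (winf : wvec R n m d) :
  increasing_seq f -> (fun k => w (f k).+1) @ \oo --> winf ->
  lyapunov winf @ \oo --> (0 : R).
Proof.
move=> fi wf; have Ms := iter_limit_Mstar fi wf.
apply: (@nonincreasing_subsequence_cvg0 _ _ f) => //.
- by move=> k; have [] := lyapunov_ge_parts winf k.
- by move=> k; exact: lyapunov_nonincreasing.
have dev0 N (v : nat -> 'cV[R]_N) (a : 'cV[R]_N) : v @ \oo --> a ->
    (fun k => v k - a) @ \oo --> (0 : 'cV[R]_N).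
  by move=> va; rewrite -(subrr a); apply: cvgB => //; exact: cvg_cst.
have x0 := dev0 _ _ _ (cvg_wx wf); have y0 := dev0 _ _ _ (cvg_wy wf).
have l0 := dev0 _ _ _ (cvg_wl wf).
have E0 (v : nat -> 'cV[R]_n) c : v @ \oo --> (0 : 'cV[R]_n) ->
    (fun k => c * inner (v k) (v k)) @ \oo --> (0 : R).
  move=> v0; rewrite -(mulr0 c) -(inner0l (0 : 'cV[R]_n)).
  by apply: cvgM; [exact: cvg_cst|exact: cvg_inner].
have H1 := cvg_block_quad0 (mat_A P) (1 + sigma1) 1 x0.
have H2 := cvg_block_quad0 (mat_B P) (1 + sigma2) tau y0.
have V0 : (fun k => \sum_j dev_y winf (f k).+1 j) @ \oo --> (0 : 'cV[R]_n).
  have := cvg_mulmx (A := \mxrow_j mat_B P j) y0.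
  by rewrite mulmx0 (eq_cvg _ _ (fun k => mxrow_mul_blocks _ _)).
have H3 : (fun k => dev_lam winf (f k).+1 - tau *: \sum_j dev_y winf (f k).+1 j)
    @ \oo --> (0 : 'cV[R]_n).
  have := cvgB (cvgZ (cvg_cst beta^-1) l0) (cvgZ (cvg_cst tau) V0).
  rewrite !scaler0 subr0; exact.
have H4 := E0 _ kappa (cvg_subsequence fi res_succ_cvg0).
have H5 : (fun k => theta * block_quad (1 + sigma2) 1 (dy (f k))) @ \oo
    --> (0 : R).
  rewrite -(mulr0 theta); apply: cvgM; first exact: cvg_cst.
  apply: cvg_block_quad0.
  exact: (cvg_subsequence fi (cvg0_of_block_img hB dy_cvg0)).
exact: (cvg0D (V := R) (cvg0D (cvg0D (cvg0D H1 H2) (E0 _ (tau + s)^-1 H3)) H4) H5).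
Qed.

(** Coercivity of [lyapunov winf] forces [x], [y] and [nu - tau V] to converge along the full
    sequence. *)
Lemma wtilde_cvg (f : nat -> nat) (winf : wvec R n m d) :
  increasing_seq f -> (fun k => w (f k).+1) @ \oo --> winf ->
  wtilde P beta w @ \oo --> winf.
Proof.
move=> fi wf; have L0 := lyapunov_cvg0 fi wf.
have X0 : (fun k => \sum_i inner (dev_x winf k.+1 i) (dev_x winf k.+1 i))
    @ \oo --> (0 : R).
  apply: (cvg0_of_le x_gap) L0 => k; first exact: sum_inner_ge0.
  by have [] := lyapunov_ge_parts winf k.
have Y0 : (fun k => \sum_j inner (dev_y winf k.+1 j) (dev_y winf k.+1 j))
    @ \oo --> (0 : R).
  apply: (cvg0_of_le y_gap) L0 => k; first exact: sum_inner_ge0.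
  by have [] := lyapunov_ge_parts winf k.
pose V k := \sum_j dev_y winf k.+1 j; pose D k := dev_lam winf k.+1 - tau *: V k.
have D0 : D @ \oo --> (0 : 'cV[R]_n).
  apply: cvg0_of_inner; apply: (cvg0_of_le lam_gap) L0 => k.
    exact: inner_ge0.
  by have [] := lyapunov_ge_parts winf k.
have V0 : V @ \oo --> (0 : 'cV[R]_n) := cvg_block_img_sum Y0.
have shift0 N (v : nat -> 'cV[R]_N) (a : 'cV[R]_N) :
    (fun k => v k - a) @ \oo --> (0 : 'cV[R]_N) -> v @ \oo --> a.
  move=> va; have -> : v = fun k => v k - a + a.
    by apply/funext => k; rewrite subrK.
  by rewrite -[X in _ --> X]add0r; apply: cvgD => //; exact: cvg_cst.
rewrite (wtriple_eta winf); apply: cvg_wtriple.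
- by apply: (shift0); exact: cvg0_of_block_img X0.
- by apply: (shift0); exact: cvg0_of_block_img Y0.
apply: (shift0).
(* The predicted multiplier differs from [lam k.+1] only by multiples of the two vanishing
   residuals. *)
have E k : lam k - beta *: mid_res k - wl winf = beta *: (D k + tau *: V k)
    + (((tau - 1) * beta) *: mid_res k + (s * beta) *: res k.+1).
  have -> : lam k = lam k.+1 + (tau * beta) *: mid_res k + (s * beta) *: res k.+1.
    by rewrite lam_iter addrAC !subrK.
  rewrite /D subrK scalerA mulfV ?gt_eqF // scale1r.
  move: (lam k.+1) (wl winf) (mid_res k) (res k.+1) => a b c e.
  by apply/colP => i; rewrite !mxE; ring.
rewrite (eq_cvg _ _ E).
exact: (cvg0D (cvg0Z _ (cvg0D D0 (cvg0Z _ V0)))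
  (cvg0D (cvg0Z _ mid_res_cvg0) (cvg0Z _ res_succ_cvg0))).
Qed.

Lemma successive_differences_cvg0 :
  (fun k => \sum_i enorm (mat_A P i *m (submxcol (x k) i
                                        - submxcol (x k.+1) i)) ^+ 2
    + \sum_j enorm (mat_B P j *m (submxcol (y k) j
                                  - submxcol (y k.+1) j)) ^+ 2)
  @ \oo --> (0 : R).
Proof.
have E N (A : 'M[R]_(n, N)) (a b : 'cV[R]_N) :
    enorm (A *m (a - b)) ^+ 2 = inner (A *m (b - a)) (A *m (b - a)).
  by rewrite enorm_sqr -opprB mulmxN innerNl innerNr opprK.
have Ex k : \sum_i enorm (mat_A P i *m (submxcol (x k) i
    - submxcol (x k.+1) i)) ^+ 2 = \sum_i inner (dx k i) (dx k i).
  by apply: eq_bigr => i _; rewrite E -submxcolB.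
have Ey k : \sum_j enorm (mat_B P j *m (submxcol (y k) j
    - submxcol (y k.+1) j)) ^+ 2 = \sum_j inner (dy k j) (dy k j).
  by apply: eq_bigr => j _; rewrite E -submxcolB.
rewrite (eq_cvg _ _ (fun k => congr2 _ (Ex k) (Ey k))).
have := cvgD dx_cvg0 dy_cvg0; rewrite addr0; exact.
Qed.

End Iteration.

Theorem theorem6 (R : realType) (n p q : nat)
    (m : 'I_p -> nat) (d : 'I_q -> nat) (P : problem R n m d)
    (hp : (1 <= p)%N) (hq : (1 <= q)%N)
    (hf : forall i, closed_proper_convex (obj_f P i))
    (hg : forall j, closed_proper_convex (obj_g P j))
    (hA : forall i, \rank (mat_A P i) = m i)
    (hB : forall j, \rank (mat_B P j) = d j)
    (hX : forall i, closed (set_X P i) /\ convex_set (set_X P i))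
    (hY : forall j, closed (set_Y P j) /\ convex_set (set_Y P j))
    (hsol : solutions P !=set0)
    (hMstar : Mstar P !=set0)
    (beta sigma1 sigma2 tau s : R)
    (hbeta : 0 < beta)
    (hsigma1 : p%:R - 1 < sigma1) (hsigma2 : q%:R - 1 < sigma2)
    (hK : Kset (tau, s))
    (w : nat -> wvec R n m d)
    (hw : GS_ADMM P beta sigma1 sigma2 tau s w) :
  [/\ (fun k : nat =>
         \sum_(i < p) enorm (mat_A P i *m (submxcol (wx (w k)) i
                                       - submxcol (wx (w k.+1)) i)) ^+ 2
         + \sum_(j < q) enorm (mat_B P j *m (submxcol (wy (w k)) j
                                         - submxcol (wy (w k.+1)) j)) ^+ 2)
        @ \oo --> (0 : R),
      (fun k : nat => enorm (residual P (wx (w k)) (wy (w k))))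
        @ \oo --> (0 : R)
    & exists2 winf : wvec R n m d, Mstar P winf & wtilde P beta w @ \oo --> winf].
Proof.
have [f fi [winf wf]] := iter_subsequence hf hg hX hY hbeta hsigma1 hsigma2
  hK hw hMstar hA hB.
have Ms := iter_limit_Mstar hf hg hX hY hbeta hsigma1 hsigma2 hK hw hMstar fi wf.
split.
- exact: (successive_differences_cvg0 hf hg hX hY hbeta hsigma1 hsigma2 hK hw).
- have r0 := res_cvg0 hf hg hX hY hbeta hsigma1 hsigma2 hK hw hMstar.
  have := cvg_inner r0 r0; rewrite inner0l => i0.
  (* The squared norm tends to 0, and the square root is continuous at 0. *)
  rewrite -(sqrtr0 R).
  exact: (cvg_comp _ Num.sqrt i0 (@sqrt_continuous R 0)).
- exists winf => //.
  exact: (wtilde_cvg hf hg hX hY hbeta hsigma1 hsigma2 hK hw hMstar hA hB fi wf).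
Qed.
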